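(* Let $s\in\mathbb{N}$, $p\in[1,\infty]$, let $p^*$ be the conjugate exponent, $\frac1p+\frac1{p^*}=1$, and let $\boldsymbol{\gamma}=(\gamma_{\mathfrak{u}})_{\mathfrak{u}\subseteq[s]}$ be non-negative weights, not all zero, such that $\gamma_{\mathfrak{w}}>0$ implies $\gamma_{\mathfrak{u}}>0$ for all $\mathfrak{u}\subset\mathfrak{w}$. Let $\mathfrak{U}=\{\mathfrak{u}\subseteq[s]:\gamma_{\mathfrak{u}}>0\}$, and let $\imath:F_{s,p,\boldsymbol{\gamma}}\hookrightarrow H_{s,p,\boldsymbol{\gamma}}$, $\imath(f)=f$, be the embedding of the $\boldsymbol{\gamma}$-weighted anchored space into the $\boldsymbol{\gamma}$-weighted ANOVA space, with inverse $\imath^{-1}:H_{s,p,\boldsymbol{\gamma}}\hookrightarrow F_{s,p,\boldsymbol{\gamma}}$. Then the operator norms $\|\imath\|_{F_{s,p,\boldsymbol{\gamma}}\hookrightarrow H_{s,p,\boldsymbol{\gamma}}}$ and $\|\imath^{-1}\|_{H_{s,p,\boldsymbol{\gamma}}\hookrightarrow F_{s,p,\boldsymbol{\gamma}}}$ are the same and are equal to \[ \sup_{\{c_{\mathfrak{u}},h_{\mathfrak{u}}\}_{\mathfrak{u}\in\mathfrak{U}}}\frac{\left(\sum_{\mathfrak{v}\in\mathfrak{U}}\gamma_{\mathfrak{v}}^{-p}\int_{D^{\mathfrak{v}}}\left|\sum_{\mathfrak{w}\subseteq[s]\setminus\mathfrak{v}}c_{\mathfrak{v}\cup\mathfrak{w}}\int_{D^{\mathfrak{w}}}h_{\mathfrak{v}\cup\mathfrak{w}}([\boldsymbol{x}_{\mathfrak{v}};\boldsymbol{t}_{\mathfrak{w}}])\prod_{j\in\mathfrak{w}}(1-t_j)\,\mathrm{d}\boldsymbol{t}_{\mathfrak{w}}\right|^p\mathrm{d}\boldsymbol{x}_{\mathfrak{v}}\right)^{1/p}}{\left(\sum_{\mathfrak{u}\in\mathfrak{U}}c_{\mathfrak{u}}^p\right)^{1/p}},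 \] where the supremum is with respect to non-negative numbers $c_{\mathfrak{u}}$ (not all zero) and functions $h_{\mathfrak{u}}\in L_p(D^{\mathfrak{u}})$ such that $\|h_{\mathfrak{u}}\|_{L_p(D^{\mathfrak{u}})}=\gamma_{\mathfrak{u}}$. Moreover, these norms are bounded from below by \[ \sup_{\{c_{\mathfrak{u}}\ge0\}_{\mathfrak{u}\in\mathfrak{U}}}\frac{\left(\sum_{\mathfrak{v}\in\mathfrak{U}}\gamma_{\mathfrak{v}}^{-p}\left(\sum_{\mathfrak{w}\subseteq[s]\setminus\mathfrak{v}}c_{\mathfrak{v}\cup\mathfrak{w}}\,\gamma_{\mathfrak{v}\cup\mathfrak{w}}\,m_{p^*}^{|\mathfrak{w}|}\right)^p\right)^{1/p}}{\left(\sum_{\mathfrak{u}\in\mathfrak{U}}c_{\mathfrak{u}}^p\right)^{1/p}}, \] where the supremum is over non-negative numbers $c_{\mathfrak{u}}$ (not all zero) and $m_{p^*}=(p^*+1)^{-1/p^*}$, with $m_\infty=1$.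
   Context: Notation: $[s]=\{1,\dots,s\}$, $D=[0,1]$, $D^{\mathfrak{u}}=D^{|\mathfrak{u}|}$ with coordinates indexed by $\mathfrak{u}\subseteq[s]$, $\mathfrak{u}^c=[s]\setminus\mathfrak{u}$, $\boldsymbol{x}_{\mathfrak{u}}=(x_j)_{j\in\mathfrak{u}}$. $[\boldsymbol{x}_{\mathfrak{v}};\boldsymbol{t}_{\mathfrak{w}}]$ (for disjoint $\mathfrak{v},\mathfrak{w}$) is the vector indexed by $\mathfrak{v}\cup\mathfrak{w}$ with entries $x_j$ for $j\in\mathfrak{v}$ and $t_j$ for $j\in\mathfrak{w}$. $f^{(\mathfrak{u})}=\prod_{j\in\mathfrak{u}}\frac{\partial}{\partial x_j}f$, $f^{(\emptyset)}=f$. $\boldsymbol{1}_I$ is the characteristic function of $I$. All functions are real-valued. $L_p(D^\emptyset)$ is identified with $\mathbb{R}$ with the absolute value as norm (integration over $D^\emptyset$ is evaluation). Anchored space: $F_{s,p,\boldsymbol{\gamma}}$ is the space of functions on $D^s$ of the form $f=\sum_{\mathfrak{u}\in\mathfrak{U}}f_{\mathfrak{u}}$ with $f_{\mathfrak{u}}(\boldsymbol{x})=\int_{D^{\mathfrak{u}}}h_{\mathfrak{u}}(\boldsymbol{t}_{\mathfrak{u}})\prod_{j\in\mathfrak{u}}\boldsymbol{1}_{[0,x_j)}(t_j)\,\mathrm{d}\boldsymbol{t}_{\mathfrak{u}}$, $h_{\mathfrak{u}}\in L_p(D^{\mathfrak{u}})$ ($f_\emptyset$ is a constant). This (anchored)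 decomposition is unique, $h_{\mathfrak{u}}=f^{(\mathfrak{u})}([\cdot_{\mathfrak{u}};\boldsymbol{0}_{\mathfrak{u}^c}])$, and the norm is $\|f\|_{F_{s,p,\boldsymbol{\gamma}}}=\big(\sum_{\mathfrak{u}\in\mathfrak{U}}\gamma_{\mathfrak{u}}^{-p}\|h_{\mathfrak{u}}\|_{L_p(D^{\mathfrak{u}})}^p\big)^{1/p}$. ANOVA space: $H_{s,p,\boldsymbol{\gamma}}$ is the space of functions of the form $f=\sum_{\mathfrak{u}\in\mathfrak{U}}f_{\mathfrak{u}}$ with $f_{\mathfrak{u}}(\boldsymbol{x})=\int_{D^{\mathfrak{u}}}g_{\mathfrak{u}}(\boldsymbol{t}_{\mathfrak{u}})\prod_{j\in\mathfrak{u}}(\boldsymbol{1}_{[0,x_j)}(t_j)-(1-t_j))\,\mathrm{d}\boldsymbol{t}_{\mathfrak{u}}$, $g_{\mathfrak{u}}\in L_p(D^{\mathfrak{u}})$. This (ANOVA) decomposition is unique, $g_{\mathfrak{u}}=\int_{D^{\mathfrak{u}^c}}f^{(\mathfrak{u})}([\cdot_{\mathfrak{u}};\boldsymbol{t}_{\mathfrak{u}^c}])\,\mathrm{d}\boldsymbol{t}_{\mathfrak{u}^c}$, and the norm is $\|f\|_{H_{s,p,\boldsymbol{\gamma}}}=\big(\sum_{\mathfrak{u}\in\mathfrak{U}}\gamma_{\mathfrak{u}}^{-p}\|g_{\mathfrak{u}}\|_{L_p(D^{\mathfrak{u}})}^p\big)^{1/p}$. Under the stated condition on the weights (positivity passes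 to subsets) the two spaces are equal as sets of functions, so $\imath$ and $\imath^{-1}$ are well defined. Conventions: for $p=\infty$ all expressions $(\sum\cdots^p)^{1/p}$ and $(\int|\cdots|^p)^{1/p}$ are read as maxima and essential suprema (e.g. the numerators become $\max_{\mathfrak{v}\in\mathfrak{U}}\gamma_{\mathfrak{v}}^{-1}\|\cdots\|_{L_\infty}$). In sums over $\mathfrak{w}\subseteq[s]\setminus\mathfrak{v}$, terms with $\mathfrak{v}\cup\mathfrak{w}\notin\mathfrak{U}$ are taken to be zero. *)

(* Defs.v *)
From HB Require Import structures.
From mathcomp Require Import all_boot all_order all_algebra.
From mathcomp Require Import all_classical all_reals all_analysis.

Set Implicit Arguments.
Unset Strict Implicit.
Unset Printing Implicit Defensive.
Import Order.TTheory GRing.Theory Num.Theory.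

Local Open Scope classical_set_scope.
Local Open Scope ring_scope.

(* The library has no n-fold product measure on tuples.  [leb_cube R n] is the
   Lebesgue measure on R^n restricted to D^n, where D = [0, 1], so that an
   integral over D^n is an integral over the whole type [n.-tuple R] against
   [leb_cube R n].  For n = 0 it is the point mass, so that L_p(D^0) is
   identified with R. *)
Section cube_measure.
Variable R : realType.

Definition leb01 (A : set R) : \bar R :=
  mrestr lebesgue_measure (measurable_itv `[0%R : R, 1%R]) A.

Let leb01_0 : leb01 set0 = 0%E.
Proof. exact: measure0. Qed.

Let leb01_ge0 A : (0 <= leb01 A)%E.
Proof. exact: measure_ge0. Qed.

Let leb01_sigma_additive : semi_sigma_additive leb01.
Proof.
exact: (@measure_semi_sigma_additive _ _ _
  (mrestr lebesgue_measure (measurable_itv `[0%R : R, 1%R]))).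
Qed.

HB.instance Definition _ := isMeasure.Build _ R _ leb01
  leb01_0 leb01_ge0 leb01_sigma_additive.

Let leb01_setT : leb01 [set: R] = 1%E.
Proof.
by rewrite /leb01 /mrestr setTI lebesgue_measure_itv/= lte_fin ltr01 oppr0 adde0.
Qed.

HB.instance Definition _ := Measure_isProbability.Build _ _ R leb01 leb01_setT.

Section power.
Variables (n : nat) (P : probability (n.-tuple R) R).

Definition cons_pair (z : R * n.-tuple R) : n.+1.-tuple R :=
  [tuple of z.1 :: z.2].

Lemma measurable_cons_pair : measurable_fun setT cons_pair.
Proof. exact: (measurable_cons measurable_fst measurable_snd). Qed.

Definition leb01_cons (A : set (n.+1.-tuple R)) : \bar R :=
  pushforward (leb01 \x P)%E cons_pair A.

Let leb01_cons0 : leb01_cons set0 = 0%E.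
Proof. by rewrite /leb01_cons /pushforward preimage_set0 measure0. Qed.

Let leb01_cons_ge0 A : (0 <= leb01_cons A)%E.
Proof. exact: (measure_ge0 (leb01 \x P)%E). Qed.

Let leb01_cons_sigma_additive : semi_sigma_additive leb01_cons.
Proof.
have mcons A : measurable A -> measurable (cons_pair @^-1` A).
  by move=> mA; rewrite -[X in measurable X]setTI; exact: measurable_cons_pair.
move=> F mF tF mUF; rewrite /leb01_cons /pushforward preimage_bigcup.
apply: measure_semi_sigma_additive.
- by move=> i; exact: mcons.
- apply/trivIsetP => /= i j _ _ ij; rewrite -preimage_setI.
  by move/trivIsetP : tF => /(_ _ _ _ _ ij) ->//; rewrite preimage_set0.
- by rewrite -preimage_bigcup; exact: mcons.
Qed.

HB.instance Definition _ := isMeasure.Build _ _ _ leb01_cons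
  leb01_cons0 leb01_cons_ge0 leb01_cons_sigma_additive.

Let leb01_cons_setT : leb01_cons setT = 1%E.
Proof.
rewrite /leb01_cons /pushforward preimage_setT -setXTT product_measure1E//.
rewrite -[X in (X * _)%E]/(leb01 setT) leb01_setT mul1e.
exact: probability_setT.
Qed.

HB.instance Definition _ :=
  Measure_isProbability.Build _ _ R leb01_cons leb01_cons_setT.

End power.

Fixpoint leb_cube (n : nat) : probability (n.-tuple R) R :=
  if n is m.+1 then leb01_cons (leb_cube m) else \d_[tuple].

End cube_measure.

(* A point of D^u, for u a subset of [s] (here 'I_s), is a #|u|.-tuple whose
   entries are listed along [enum u]; [coord x j] is its coordinate x_j, for
   j in u (and 0 for j outside u). *)
Section coordinates.
Variables (R : realType) (s : nat).
Implicit Types (u v w : {set 'I_s}) (j : 'I_s).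

Definition coord u (x : #|u|.-tuple R) j : R := nth 0 x (index j (enum u)).

(* [x_v; t_w] *)
Definition glue v w (x : #|v|.-tuple R) (t : #|w|.-tuple R) :
    #|v :|: w|.-tuple R :=
  [tuple (if enum_val i \in v then coord x (enum_val i)
          else coord t (enum_val i)) | i < #|v :|: w|].

Definition cube : set (s.-tuple R) := [set x | forall j, 0 <= tnth x j <= 1].

End coordinates.
Arguments cube : clear implicits.

Section weighted_spaces.
Variables (R : realType) (s : nat) (p : \bar R) (gamma : {set 'I_s} -> R).
Implicit Types (u v w : {set 'I_s}) (f : s.-tuple R -> R).
Implicit Types (k : R -> R -> R) (h : forall u, #|u|.-tuple R -> R).

Definition active : {set {set 'I_s}} := [set u | 0 < gamma u]%SET.

(* p ranges over [1, +oo]; the value at -oo is irrelevant. *)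
Definition lp_norm (c : {set 'I_s} -> R) : \bar R :=
  match p with
  | r%:E => ((\sum_(u in active) (c u `^ r)%:E) `^ r^-1)%E
  | +oo%E => \big[maxe/0%E]_(u in active) (c u)%:E
  | -oo%E => 0%E
  end.

(* (sum_u gamma_u^-p N_u^p)^(1/p), or max_u gamma_u^-1 N_u if p = +oo,
   for N_u >= 0. *)
Definition weighted_lp_norm (N : {set 'I_s} -> \bar R) : \bar R :=
  match p with
  | r%:E => ((\sum_(u in active) (gamma u `^ (- r))%:E * N u `^ r) `^ r^-1)%E
  | +oo%E => \big[maxe/0%E]_(u in active) ((gamma u)^-1%:E * N u)%E
  | -oo%E => 0%E
  end.

Definition Lp_norm u (g : #|u|.-tuple R -> R) : \bar R :=
  'N[leb_cube R #|u|]_p[EFin \o g]%E.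

Definition anchored_kernel (x t : R) : R := \1_(`[0, x[%classic) t.

Definition anova_kernel (x t : R) : R := \1_(`[0, x[%classic) t - (1 - t).

Definition component k u (g : #|u|.-tuple R -> R) (x : s.-tuple R) : R :=
  \int[leb_cube R #|u|]_t (g t * \prod_(j in u) k (tnth x j) (coord t j)).

(* Functions on D^s are represented by functions on R^s of which only the
   values on D^s matter. *)
Definition decomposition k f h : Prop :=
  (forall u, u \in active -> h u \in Lfun (leb_cube R #|u|) p) /\
  (forall x, cube R s x -> f x = \sum_(u in active) component k (h u) x).

(* For k = anchored_kernel this is the anchored space F_{s,p,gamma}, and for
   k = anova_kernel the ANOVA space H_{s,p,gamma}. *)
Definition space k : set (s.-tuple R -> R) :=
  [set f | exists h, decomposition k f h].

(* The norm of f in [space k], read off its decomposition, which is unique up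
   to null sets; +oo if f is not in [space k]. *)
Definition space_norm k f : \bar R :=
  xget +oo%E [set weighted_lp_norm (fun u => Lp_norm (h u))
             | h in decomposition k f].

(* The operator norm of the embedding f |-> f of [space k] into [space k']. *)
Definition embedding_norm k k' : \bar R :=
  ereal_sup [set (space_norm k' f / space_norm k f)%E
            | f in [set f | space k f /\ exists2 x, cube R s x & f x != 0]].

Definition mixed (c : {set 'I_s} -> R) h v (x : #|v|.-tuple R) : R :=
  \sum_(w : {set 'I_s} | (w \subset ~: v) && (v :|: w \in active))
    c (v :|: w) *
    \int[leb_cube R #|w|]_t
      (h (v :|: w) (glue x t) * \prod_(j in w) (1 - coord t j)).

End weighted_spaces.

(* m_q = (q + 1)^(-1/q), with m_oo = 1 *)
Definition m_const (R : realType) (q : \bar R) : R :=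
  if q is r%:E then (r + 1) `^ (- r^-1) else 1.

(* Main.v *)
Require Import Defs.
From HB Require Import structures.
From mathcomp Require Import all_boot all_order all_algebra.
From mathcomp Require Import all_classical all_reals all_analysis.
From mathcomp Require Import measurable_realfun ess_sup_inf ring lra.
Import Defs.

Set Implicit Arguments.
Unset Strict Implicit.
Unset Printing Implicit Defensive.
Import Order.TTheory GRing.Theory Num.Theory.

Local Open Scope classical_set_scope.
Local Open Scope ring_scope.

(* Since 1_[0,x)(t) = (1_[0,x)(t) - (1 - t)) + (1 - t), expanding the product of
   the anchored kernels over u as a sum over v subset of u and integrating out
   the coordinates in w = u \ v turns an anchored decomposition (h_u) into the
   ANOVA decomposition
     g_v = sum_w int h_{v u w}([x_v; t_w]) prod_{j in w} (1 - t_j) dt_w.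
   The converse transformation is the same with (-1)^|w| in front of the w-th
   term, so conjugating by the isometry h_u -> (-1)^|u| h_u identifies the two
   operators and hence their norms; normalising the h_u to norm gamma_u and
   putting the factors into c_u gives the supremum.  This needs the uniqueness
   of the decompositions: for anchored ones, setting x_j = 0 outside u isolates
   (by induction on u) the integrals of h_u over boxes, and boxes generate the
   sigma-algebra; for ANOVA ones, one converts to an anchored one and uses that
   the transformation is triangular.
   The lower bound comes from h_u = gamma_u prod_{j in u} phi(t_j), with phi
   (nearly) extremal in Hoelder's inequality for int phi(t) (1 - t) dt. *)

(** * Boxes in the cube *)

Section boxes.
Context d (T : measurableType d).

Definition box n (A : 'I_n -> set T) : set (n.-tuple T) :=
  [set t | forall i, A i (tnth t i)].

Definition boxes n (G : set (set T)) : set (set (n.-tuple T)) :=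
  [set X | exists2 A : 'I_n -> set T, (forall i, G (A i)) & X = box A].

Lemma measurable_box n (A : 'I_n -> set T) :
  (forall i, measurable (A i)) -> measurable (box A).
Proof.
move=> mA.
rewrite (_ : box A = \big[setI/setT]_(i < n) ((@tnth n T)^~ i @^-1` A i)).
  apply: bigsetI_measurable => i _.
  by rewrite -[X in measurable X]setTI; exact: measurable_tnth.
by rewrite -bigcap_seq; apply/seteqP; split => t /= tA i;
  [move=> _|]; apply: tA; rewrite /= ?mem_index_enum.
Qed.

Lemma setI_closed_boxes n (G : set (set T)) :
  setI_closed G -> setI_closed (@boxes n G).
Proof.
move=> GI _ _ [A GA ->] [B GB ->]; exists (fun i => A i `&` B i).
  by move=> i; exact: GI.
by apply/seteqP; split => t /= => [[tA tB] i|tAB]; split=> // i; case: (tAB i).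
Qed.

(** The sigma-algebra on tuples is generated by preimages under single coordinates. Such a preimage
    is a box whose other sides are all [setT], hence the assumption [G setT]. *)
Lemma measurable_boxesE n (G : set (set T)) :
  @measurable _ T = <<s G >> -> G setT ->
  @measurable _ (n.-tuple T) = <<s @boxes n G >>.
Proof.
move=> mG GT; apply/seteqP; split.
- apply: smallest_sub; first exact: smallest_sigma_algebra.
  rewrite -bigcup_seq => X [/= i _] [B mB <-]; rewrite setTI.
  move: mB; rewrite mG => mB.
  (* Good sets: those whose [i]-th cylinder lies in the sigma-algebra of the boxes. They form a
     sigma-algebra containing [G]. *)
  pose S := [set B | <<s @boxes n G >> ((@tnth n T)^~ i @^-1` B)].
  suff : <<s G >> `<=` S by exact.
  apply: smallest_sub.
    split.
    + by rewrite /S /= preimage_set0; exact: sigma_algebra0.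
    + move=> C SC; rewrite /S /= setTD preimage_setC.
      by rewrite -[X in _ X]setTD; exact: sigma_algebraCD.
    + move=> F SF; rewrite /S /= preimage_bigcup.
      exact: sigma_algebra_bigcup.
  move=> C GC; apply: sub_sigma_algebra.
  exists (fun j => if j == i then C else setT) => [j|]; first by case: ifP.
  apply/seteqP; split => t /= => [Ct j|/(_ i)]; last by rewrite eqxx.
  by case: eqP => // ->.
- apply: smallest_sub; first exact: sigma_algebra_measurable.
  move=> _ [A GA ->]; apply: measurable_box => i; rewrite mG.
  exact: sub_sigma_algebra.
Qed.

(** Boxes with measurable sides form a generating pi-system, and finiteness of [m1] lets the
    constant sequence [setT] exhaust the space. *)
Lemma box_measure_unique n (R : realType) (m1 m2 : {measure set (n.-tuple T) -> \bar R}) :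
  (m1 setT < +oo)%E ->
  (forall A : 'I_n -> set T, (forall i, measurable (A i)) -> m1 (box A) = m2 (box A)) ->
  forall X, measurable X -> m1 X = m2 X.
Proof.
move=> m1T m12; apply: (measure_unique (@boxes n measurable) (fun=> setT)) => //.
- apply: measurable_boxesE => //; apply/esym/seteqP; split.
    by apply: smallest_sub => //; exact: sigma_algebra_measurable.
  exact: sub_sigma_algebra.
- by apply: setI_closed_boxes => A B; exact: measurableI.
- by move=> _; exists (fun=> setT) => //; apply/seteqP.
- by rewrite bigcup_const//; exists 0%N.
- by move=> _ [A mA ->]; exact: m12.
Qed.

End boxes.

Section cube.
Variable R : realType.

Lemma leb_cube_box n (A : 'I_n -> set R) : (forall i, measurable (A i)) ->
  leb_cube R n (box A) = (\prod_(i < n) leb01 (A i))%E.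
Proof.
elim: n A => [|n ih] A mA.
  rewrite big_ord0 /= diracE mem_set//; by case.
rewrite big_ord_recl -ih//=.
rewrite /leb01_cons /pushforward (_ : _ @^-1` _ =
    A ord0 `*` box (fun i => A (lift ord0 i))) ?product_measure1E//.
  exact: measurable_box.
apply/seteqP; split=> -[y t] /=.
- move=> tA; split=> [|i]; first exact: (tA ord0).
  by have := tA (lift ord0 i); rewrite tnthS.
- by move=> [Ay tA] i; case: (unliftP ord0 i) => [j|] ->//; rewrite tnthS.
Qed.

End cube.

(** * Coordinates indexed by subsets, and gluing *)

Section coord.
Variables (R : realType) (s : nat).
Implicit Types (u v w : {set 'I_s}) (j : 'I_s).

Lemma index_enum_val u (i : 'I_#|u|) : index (enum_val i) (enum u) = i.
Proof.
by rewrite (enum_val_nth (enum_val i)) index_uniq ?enum_uniq// -cardE.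
Qed.

Lemma coord_enum_val u (t : #|u|.-tuple R) (i : 'I_#|u|) :
  coord t (enum_val i) = tnth t i.
Proof. by rewrite /coord index_enum_val -tnth_nth. Qed.

Lemma coord_inj u (t t' : #|u|.-tuple R) :
  {in u, coord t =1 coord t'} -> t = t'.
Proof.
move=> tt'; apply: eq_from_tnth => i.
by rewrite -!coord_enum_val tt'// enum_valP.
Qed.

Lemma coord_glue v w (x : #|v|.-tuple R) (t : #|w|.-tuple R) j :
  j \in v :|: w -> coord (glue x t) j = if j \in v then coord x j else coord t j.
Proof.
move=> jvw; rewrite -{1}(enum_rankK_in jvw jvw) coord_enum_val tnth_mktuple.
by rewrite enum_rankK_in.
Qed.

(* Stands in for a transport along [u = v]. *)
Lemma eq_coord_fun (h : forall u, #|u|.-tuple R -> R) u v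
    (t : #|u|.-tuple R) (t' : #|v|.-tuple R) :
  u = v -> {in u, coord t =1 coord t'} -> h u t = h v t'.
Proof. by move=> uv; subst v => /coord_inj ->. Qed.

Lemma measurable_coord u j :
  measurable_fun setT (fun t : #|u|.-tuple R => coord t j).
Proof.
have [ju|ju] := boolP (j \in u).
  rewrite (_ : (fun t => _) = (@tnth _ R)^~ (enum_rank_in ju j)).
    exact: measurable_tnth.
  by apply/funext => t; rewrite -coord_enum_val enum_rankK_in.
rewrite (_ : (fun t => _) = cst 0)//; apply/funext => t.
by rewrite /coord nth_default// memNindex ?mem_enum// size_tuple cardE.
Qed.

Definition glue_pair v w (z : #|v|.-tuple R * #|w|.-tuple R) :
  #|v :|: w|.-tuple R := glue z.1 z.2.

Lemma measurable_glue_pair v w : measurable_fun setT (@glue_pair v w).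
Proof.
apply/measurable_fun_tnthP => i.
have [iv|iv] := boolP (enum_val i \in v).
  rewrite (_ : _ \o _ = (fun x => coord x (enum_val i)) \o fst).
    exact: (measurableT_comp (measurable_coord (enum_val i)) measurable_fst).
  by apply/funext => z; rewrite /= tnth_mktuple iv.
rewrite (_ : _ \o _ = (fun x => coord x (enum_val i)) \o snd).
  exact: (measurableT_comp (measurable_coord (enum_val i)) measurable_snd).
by apply/funext => z; rewrite /= tnth_mktuple (negbTE iv).
Qed.

Lemma big_setU_subC (S : Type) (idx : S) (op : Monoid.com_law idx) v w
    (F : 'I_s -> S) : w \subset ~: v ->
  \big[op/idx]_(j in v :|: w) F j =
  op (\big[op/idx]_(j in v) F j) (\big[op/idx]_(j in w) F j).
Proof.
move=> /fintype.subsetP wv; rewrite (bigID (mem v))/=; congr (op _ _); apply: eq_bigl => j.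
  by rewrite inE andb_orl andbb; case: (j \in v); rewrite ?orbT ?andbF.
rewrite inE; have := wv j; case: (j \in w) => [/(_ isT)|_]; last first.
  by rewrite orbF andbN.
by rewrite inE => ->; rewrite orbT.
Qed.

(** On a box both sides are the product of the side lengths over [v] and over [w];
    [box_measure_unique] extends the equality to measurable sets. *)
Lemma leb_cube_glue v w (X : set (#|v :|: w|.-tuple R)) :
  w \subset ~: v -> measurable X ->
  leb_cube R #|v :|: w| X =
  pushforward (leb_cube R #|v| \x leb_cube R #|w|)%E (@glue_pair v w) X.
Proof.
move=> wsv mX; have wv j : j \in w -> j \notin v.
  by move/(fintype.subsetP wsv); rewrite inE.
have mg := @measurable_glue_pair v w.
pose m1 : {measure set _ -> \bar R} := pushforward
  (leb_cube R #|v| \x leb_cube R #|w|)%E (@glue_pair v w).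
suff : leb_cube R #|v :|: w| X = m1 mg X by [].
apply: box_measure_unique mX; first exact: fin_num_fun_lty.
move=> A mA.
(* The sides are relabelled by elements of ['I_s] instead of positions, so that one family restricts
   to [v] and to [w]. The value [setT] off [v :|: w] is a filler. *)
pose B j : set R := if [pick i : 'I_#|v :|: w| | enum_val i == j] is Some i
  then A i else setT.
have BE i : B (enum_val i) = A i.
  rewrite /B; case: pickP => [k /eqP/enum_val_inj -> //|/(_ i)].
  by rewrite eqxx.
have mB j : measurable (B j) by rewrite /B; case: pickP.
have boxE u (t : #|u|.-tuple R) :
    box (fun i => B (enum_val i)) t <-> forall j, j \in u -> B j (coord t j).
  split=> [Bt j ju|Bt i]; last by rewrite -coord_enum_val; apply/Bt/enum_valP.
  by rewrite -(enum_rankK_in ju ju) coord_enum_val; exact: Bt.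
apply: (etrans (leb_cube_box mA)).
under eq_bigr do rewrite -BE.
rewrite -(big_enum_val (fun j => leb01 (B j))).
rewrite big_setU_subC//=.
have -> : m1 mg (box A) = (leb_cube R #|v| (box (fun i => B (enum_val i))) *
    leb_cube R #|w| (box (fun i => B (enum_val i))))%E.
  rewrite -product_measure1E; try exact: measurable_box.
  rewrite /m1 /= /pushforward; congr (_ _); apply/seteqP; split => -[x t] /=.
    rewrite (_ : A = fun i => B (enum_val i)); last exact/funext.
    move/boxE => BA; split; apply/boxE => j ju.
      by have := BA j; rewrite coord_glue inE ju//; exact.
    have := BA j; rewrite coord_glue inE ju ?orbT// (negbTE (wv _ ju)).
    exact.
  move=> [/boxE Bx /boxE Bt].
  rewrite (_ : A = fun i => B (enum_val i)); last exact/funext.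
  apply/boxE => j jvw; rewrite coord_glue//; case: ifPn => [|jv]; first exact: Bx.
  by apply: Bt; move: jvw; rewrite inE (negbTE jv).
by rewrite !leb_cube_box// -!(big_enum_val (fun j => leb01 (B j))).
Qed.

End coord.

(** * Fubini and Tonelli theorems for gluing *)

Section glue_integral.
Variables (R : realType) (s : nat).
Implicit Types (u v w : {set 'I_s}).

Notation leb u := (leb_cube R #|u|).

Section disjoint.
Variables v w : {set 'I_s}.
Hypothesis wv : w \subset ~: v.

Lemma ge0_integral_glue_pair (F : #|v :|: w|.-tuple R -> \bar R) :
  measurable_fun setT F -> (forall t, (0 <= F t)%E) ->
  (\int[leb (v :|: w)]_t F t =
   \int[leb v \x leb w]_z F (glue_pair z))%E.
Proof.
move=> mF F0; have mg := @measurable_glue_pair R s v w.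
rewrite (eq_measure_integral (pushforward (leb v \x leb w)%E (@glue_pair R s v w)))//.
  by rewrite ge0_integral_pushforward.
by move=> A mA _; exact: leb_cube_glue.
Qed.

Lemma integrable_glue_pair (F : #|v :|: w|.-tuple R -> \bar R) :
  (leb (v :|: w)).-integrable setT F ->
  (leb v \x leb w)%E.-integrable setT (F \o @glue_pair R s v w).
Proof.
move=> /integrableP[mF iF]; apply/integrableP; split.
  exact: (measurableT_comp mF (@measurable_glue_pair R s v w)).
have ma : measurable_fun setT (abse \o F) by exact: measurableT_comp.
by rewrite -(ge0_integral_glue_pair ma)// => t; exact: abse_ge0.
Qed.

Lemma ge0_integral_glue (F : #|v :|: w|.-tuple R -> \bar R) :
  measurable_fun setT F -> (forall t, (0 <= F t)%E) ->
  (\int[leb (v :|: w)]_t F t =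
   \int[leb v]_x \int[leb w]_t F (glue x t))%E.
Proof.
move=> mF F0; rewrite ge0_integral_glue_pair// fubini_tonelli1//.
exact: (measurableT_comp mF (@measurable_glue_pair R s v w)).
Qed.

Lemma ae_integrable_glue (F : #|v :|: w|.-tuple R -> \bar R) :
  (leb (v :|: w)).-integrable setT F ->
  {ae leb v, forall x, (leb w).-integrable setT (fun t => F (glue x t))}.
Proof. by move/integrable_glue_pair/ae_integrable1. Qed.

Lemma Rintegral_glue (F : #|v :|: w|.-tuple R -> R) :
  (leb (v :|: w)).-integrable setT (EFin \o F) ->
  \int[leb (v :|: w)]_t F t =
  \int[leb v]_x \int[leb w]_t F (glue x t).
Proof.
move=> iF; have mg := @measurable_glue_pair R s v w.
have ig := integrable_glue_pair iF.
congr fine.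
rewrite (eq_measure_integral (pushforward (leb v \x leb w)%E (@glue_pair R s v w))).
  rewrite integral_pushforward//; last exact: measurable_int iF.
  rewrite -integral12_prod_meas1//.
  (* The inner integral is known to be finite only for almost every [x], so it agrees with its
     [fine] almost everywhere. *)
  apply: ae_eq_integral => //.
  - exact: (measurable_fubini_F ig).
  - apply/measurable_EFinP.
    exact: (measurableT_comp (fine_measurable measurableT) (measurable_fubini_F ig)).
  - apply: filterS (ae_integrable_glue iF) => x ix _.
    by rewrite fineK// integrable_fin_num.
by move=> A mA _; exact: leb_cube_glue.
Qed.

Lemma measurable_Rintegral_glue (F : #|v :|: w|.-tuple R -> R) :
  (leb (v :|: w)).-integrable setT (EFin \o F) ->
  measurable_fun setT (fun x => \int[leb w]_t F (glue x t)).
Proof.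
move=> /integrable_glue_pair/measurable_fubini_F mF.
exact: (measurableT_comp (fine_measurable measurableT) mF).
Qed.

(** Almost every section of a null set is null, because the measures of the sections integrate to
    the measure of the set. *)
Lemma ae_glue (P : #|v :|: w|.-tuple R -> Prop) :
  {ae leb (v :|: w), forall t, P t} ->
  {ae leb v, forall x, {ae leb w, forall t, P (glue x t)}}.
Proof.
move=> [N [mN N0 PN]].
have mg := @measurable_glue_pair R s v w.
pose M := @glue_pair R s v w @^-1` N.
have mM : measurable M by rewrite -[M]setTI; exact: mg.
have M0 : (\int[leb v]_x leb w (xsection M x) = 0)%E.
  by rewrite -[LHS]/((leb v \x leb w)%E M) -N0 leb_cube_glue.
have : ae_eq (leb v) setT (leb w \o xsection M) (cst 0%E).
  apply/ae_eq_integral_abs => //; first exact: measurable_fun_xsection.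
  by rewrite -[RHS]M0; apply: eq_integral => x _; rewrite gee0_abs.
apply: filterS => x /(_ I) Mx0; exists (xsection M x); split => //.
  exact: measurable_xsection.
move=> t Pt; rewrite /xsection/= inE; exact: PN.
Qed.

End disjoint.

End glue_integral.

(** * Norms and partial integrals *)

Section Lnorm_ae.
Context d (T : measurableType d) (R : realType).
Variable mu : {measure set T -> \bar R}.
Implicit Types (f g : T -> R) (p : \bar R).
Local Open Scope ereal_scope.

Lemma ae_le_Lnorm p f g : 1 <= p ->
  measurable_fun setT f -> measurable_fun setT g ->
  {ae mu, forall x, (`|f x| <= `|g x|)%R} ->
  'N[mu]_p[EFin \o f] <= 'N[mu]_p[EFin \o g].
Proof.
rewrite unlock; case: p => [r|_|//] => [|mf mg fg].
  rewrite lee_fin => r1 mf mg fg.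
  have r0 : (0 <= r)%R by rewrite (le_trans _ r1).
  have mpow h : measurable_fun setT h -> measurable_fun setT (fun x : T => `|(h x : R)%:E| `^ r).
    move=> mh; apply: (measurableT_comp (measurable_poweR r)).
    by apply: measurableT_comp => //; exact/measurable_EFinP.
  apply: gt0_ler_poweR; first by rewrite invr_ge0.
  - by rewrite in_itv/= leey andbT; apply: integral_ge0 => x _; rewrite lee_fin powR_ge0.
  - by rewrite in_itv/= leey andbT; apply: integral_ge0 => x _; rewrite lee_fin powR_ge0.
  apply: ae_ge0_le_integral => //.
  - by move=> x _; exact: poweR_ge0.
  - exact: mpow.
  - by move=> x _; exact: poweR_ge0.
  - exact: mpow.
  apply: filterS fg => x fgx _ /=; rewrite lee_fin.
  by apply: ge0_ler_powR => //; rewrite nnegrE normr_ge0.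
case: ifP => // _; apply: le_ess_sup; apply: filterS fg => x fgx /=.
by rewrite lee_fin.
Qed.

Lemma ae_eq_Lnorm p f g : 1 <= p ->
  measurable_fun setT f -> measurable_fun setT g ->
  {ae mu, forall x, f x = g x} ->
  'N[mu]_p[EFin \o f] = 'N[mu]_p[EFin \o g].
Proof.
move=> p1 mf mg fg; apply/eqP; rewrite eq_le !ae_le_Lnorm//.
  by apply: filterS fg => x ->.
by apply: filterS fg => x ->.
Qed.

Lemma Lfun_normP p f : f \in Lfun mu p <->
  measurable_fun setT f /\ 'N[mu]_p[EFin \o f] < +oo.
Proof.
split=> [/andP[]|[mf Nf]]; first by rewrite !inE.
by apply/andP; rewrite !inE.
Qed.

Lemma ae_le_Lfun p f g : 1 <= p -> measurable_fun setT f -> g \in Lfun mu p ->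
  {ae mu, forall x, (`|f x| <= `|g x|)%R} -> f \in Lfun mu p.
Proof.
move=> p1 mf /Lfun_normP[mg Ng] fg; apply/Lfun_normP; split=> //.
by apply: le_lt_trans Ng; exact: ae_le_Lnorm.
Qed.

End Lnorm_ae.

Section Lnorm_probability.
Context d (T : measurableType d) (R : realType).
Variable P : probability T R.
Implicit Types (f : T -> R) (p : \bar R).
Local Open Scope ereal_scope.

(* [probability_setT] does not rewrite once [P] is coerced to a measure. *)
Lemma measure_probT : (P : {measure set T -> \bar R}) setT = 1.
Proof. exact: probability_setT. Qed.

(** For finite [p > 1] this is Hoelder's inequality against the constant 1, which has norm 1 on a
    probability space; for [p = +oo] the essential bound is integrated. *)
Lemma le_Lnorm1 p f : 1 <= p -> measurable_fun setT f ->
  'N[P]_1[EFin \o f] <= 'N[P]_p[EFin \o f].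
Proof.
case: p => [r|_ mf|//]; last first.
  rewrite Lnorm1 unlock measure_probT lte01.
  set M := ess_sup _ _.
  have M0 : 0 <= M.
    by apply: ess_sup_gee; rewrite ?measure_probT ?lte01//; apply: nearW => x; exact: abse_ge0.
  rewrite -[leRHS]mule1 -measure_probT -integral_cst//.
  apply: ae_ge0_le_integral => //.
    by apply: measurableT_comp => //; exact/measurable_EFinP.
  by apply: filterS (ess_sup_ge P (abse \o (EFin \o f))) => x + _.
rewrite lee_fin le_eqVlt => /predU1P[<-//|r1 mf].
have r0 : (0 < r)%R by rewrite (lt_trans _ r1).
have q0 : (0 < (1 - r^-1)^-1)%R by rewrite invr_gt0 subr_gt0 invf_lt1.
have := @hoelder _ _ _ P f (cst 1%R) r _ mf (measurable_cst _) r0 q0.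
rewrite invrK addrC subrK => /(_ erefl).
rewrite (_ : (f \* cst 1)%R = f); last by apply/funext => x /=; rewrite mulr1.
move=> /le_trans; apply.
by rewrite Lnorm_cst1 measure_probT poweR1r mule1.
Qed.

Lemma Lfun_integrable1 p f : 1 <= p -> f \in Lfun P p ->
  P.-integrable setT (EFin \o f).
Proof.
move=> p1 fp; apply/Lfun1_integrable.
apply: (Lfun_subset (p := 1) (q := p)) => //.
by rewrite measure_probT.
Qed.

End Lnorm_probability.

Section partial_integral.
Variables (R : realType) (s : nat) (v w : {set 'I_s}).
Hypothesis wv : w \subset ~: v.

Notation leb u := (leb_cube R #|u|).
Implicit Types F G : #|v :|: w|.-tuple R -> R.

Lemma normr_Rintegral_glue p F (x : #|v|.-tuple R) : (1 <= p)%E ->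
  (leb w).-integrable setT (fun t => (F (glue x t))%:E) ->
  (`|\int[leb w]_t F (glue x t)|%:E <=
   'N[leb w]_p[EFin \o (fun t => F (glue x t))])%E.
Proof.
move=> p1 iF; rewrite EFin_normr_Rintegral//.
have mF : measurable_fun setT (fun t => F (glue x t)).
  by apply/measurable_EFinP; exact: measurable_int iF.
apply: le_trans (le_Lnorm1 (leb w) p1 mF).
by rewrite Lnorm1; apply: le_abse_integral => //; exact: measurable_int iF.
Qed.

(** Integrating out [w] is a contraction of $L_p$: each fibre is a probability space, so the inner
    integral is at most the norm on the fibre. For finite [p] Tonelli recombines these norms; for
    [p = +oo] the essential bound passes to almost every fibre. *)
Lemma Lnorm_Rintegral_glue p F : (1 <= p)%E -> F \in Lfun (leb (v :|: w)) p ->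
  ('N[leb v]_p[EFin \o (fun x => (\int[leb w]_t F (glue x t))%R)] <=
   'N[leb (v :|: w)]_p[EFin \o F])%E.
Proof.
move=> p1 Fp; have iF := Lfun_integrable1 p1 Fp.
have [mF _] := (Lfun_normP _ _ _).1 Fp.
have mPhi := measurable_Rintegral_glue wv iF.
have aeN : {ae leb v, forall x, (`|\int[leb w]_t F (glue x t)|%:E <=
    'N[leb w]_p[EFin \o (fun t => F (glue x t))])%E}.
  apply: filterS (ae_integrable_glue wv iF) => x.
  exact: normr_Rintegral_glue.
case: p p1 Fp aeN => [r r1 Fp aeN|_ Fp aeN|//]; last first.
  rewrite unlock !measure_probT lte01; apply/ess_supP.
  have aeM := ae_glue wv (ess_sup_ge (leb (v :|: w)) (abse \o (EFin \o F))).
  apply: filterS2 aeN aeM => x /= Nx Mx; apply: (le_trans Nx).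
  by rewrite unlock measure_probT lte01; apply/ess_supP.
have r0 : (0 < r)%R by rewrite (lt_le_trans ltr01).
have mpow d (T : measurableType d) (h : T -> R) :
    measurable_fun setT h -> measurable_fun setT (fun x => `|(h x)%:E| `^ r)%E.
  move=> mh; apply: (measurableT_comp (measurable_poweR r)).
  by apply: measurableT_comp => //; exact/measurable_EFinP.
rewrite unlock; apply: gt0_ler_poweR.
- by rewrite invr_ge0 ltW.
- by rewrite in_itv/= leey andbT; apply: integral_ge0 => x _; rewrite lee_fin powR_ge0.
- by rewrite in_itv/= leey andbT; apply: integral_ge0 => x _; rewrite lee_fin powR_ge0.
rewrite [leRHS](ge0_integral_glue wv); last 2 first.
- exact: mpow.
- by move=> t; apply poweR_ge0.
apply: ae_ge0_le_integral => //.
- by move=> x _; rewrite lee_fin powR_ge0.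
- exact: mpow.
- by move=> x _; apply: integral_ge0 => t _; apply poweR_ge0.
- apply: (measurable_fun_fubini_tonelli_F
    (fun z => `|(F (glue_pair z))%:E| `^ r)%E).
    apply: (mpow _ _ (F \o @glue_pair R s v w)).
    exact: (measurableT_comp mF (@measurable_glue_pair R s v w)).
  by move=> z; apply poweR_ge0.
apply: filterS aeN => x Nx _.
(* The inner integral of $|F|^r$ is the [r]-th power of the norm on the fibre, so it remains to
   raise [Nx] to the power [r]. *)
rewrite -[leRHS](@poweR_Lnorm _ _ _ (leb w) (fun t => (F (glue x t))%:E) r) ?gt_eqF//.
apply: gt0_ler_poweR => //.
- exact: ltW.
- by rewrite in_itv/= leey andbT lee_fin.
- by rewrite in_itv/= leey andbT Lnorm_ge0.
Qed.

Lemma Lfun_Rintegral_glue p F : (1 <= p)%E -> F \in Lfun (leb (v :|: w)) p ->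
  (fun x => \int[leb w]_t F (glue x t)) \in Lfun (leb v) p.
Proof.
move=> p1 Fp; apply/Lfun_normP; split.
  exact: (measurable_Rintegral_glue wv (Lfun_integrable1 p1 Fp)).
apply: (le_lt_trans (Lnorm_Rintegral_glue p1 Fp)).
by have [] := (Lfun_normP _ _ _).1 Fp.
Qed.

Lemma ae_eq_Rintegral_glue F G :
  (leb (v :|: w)).-integrable setT (EFin \o F) ->
  (leb (v :|: w)).-integrable setT (EFin \o G) ->
  {ae leb (v :|: w), forall t, F t = G t} ->
  {ae leb v, forall x,
    \int[leb w]_t F (glue x t) = \int[leb w]_t G (glue x t)}.
Proof.
move=> iF iG /(ae_glue wv).
apply: filterS3 (ae_integrable_glue wv iF) (ae_integrable_glue wv iG) => x ix jx FG.
congr fine; apply: ae_eq_integral => //.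
- exact: measurable_int ix.
- exact: measurable_int jx.
- by apply: filterS FG => t /= ->.
Qed.

End partial_integral.

Section weight.
Variables (R : realType) (s : nat).
Implicit Types (u v w : {set 'I_s}).
Notation leb u := (leb_cube R #|u|).

(** The faces $t_j=1$ are null, so the interval can be half-open, as the comparison with indicators
    of $[0,x)$ requires. For [j] outside [u] the default value 0 of [coord] lies in it too. *)
Lemma ae_coord_itv u :
  {ae leb u, forall t, forall j, 0 <= coord t j < 1}.
Proof.
pose A := box (fun=> `[0, 1[%classic : set R) : set (#|u|.-tuple R).
have mA : measurable A by exact: measurable_box.
exists (~` A); split.
- exact: measurableC.
- rewrite (@probability_setC _ _ _ (leb u))// leb_cube_box// big1 ?subee// => i _.
  rewrite /leb01 /mrestr setIidl; last by move=> x; rewrite /= !in_itv/= => /andP[-> /ltW].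
  by rewrite lebesgue_measure_itv/= lte_fin ltr01 oppr0 adde0.
- apply: subsetC => t At j.
  have [ju|ju] := boolP (j \in u).
    have := At (enum_rank_in ju j).
    by rewrite -coord_enum_val enum_rankK_in//= in_itv.
  by rewrite /coord nth_default ?lexx ?ltr01// memNindex ?mem_enum// size_tuple cardE.
Qed.

Lemma measurable_prod_coord u w (K : 'I_s -> R -> R) :
  (forall j, measurable_fun setT (K j)) ->
  measurable_fun setT (fun t : #|u|.-tuple R => \prod_(j in w) K j (coord t j)).
Proof.
move=> mK; under eq_fun do rewrite -big_enum.
apply: measurable_prod => j _.
exact: (measurableT_comp (mK j) (measurable_coord j)).
Qed.

(** Multiplication by a function bounded by 1 preserves $L_p$. The bound on [K] is asked on $[0,1]$
    only, where almost all coordinates lie. *)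
Lemma Lfun_prod_coord p u w (K : 'I_s -> R -> R) (h : #|u|.-tuple R -> R) :
  (1 <= p)%E -> (forall j, measurable_fun setT (K j)) ->
  (forall j x, 0 <= x <= 1 -> `|K j x| <= 1) -> h \in Lfun (leb u) p ->
  (fun t => h t * \prod_(j in w) K j (coord t j)) \in Lfun (leb u) p.
Proof.
move=> p1 mK K1 hp; have [mh _] := (Lfun_normP _ _ _).1 hp.
apply: ae_le_Lfun hp _ => //.
  by apply: measurable_funM => //; exact: measurable_prod_coord.
apply: filterS (ae_coord_itv u) => t t01.
rewrite normrM ler_piMr// normr_prod prodr_ile1// => j _.
by rewrite normr_ge0/= K1//; have /andP[-> /ltW] := t01 j.
Qed.

Lemma measurable_onem : measurable_fun setT (fun x : R => 1 - x).
Proof. exact: measurable_funB. Qed.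

Lemma normr_onem_le1 (x : R) : 0 <= x <= 1 -> `|1 - x| <= 1.
Proof. by move=> /andP[x0 x1]; rewrite ger0_norm ?subr_ge0// lerBlDr lerDl. Qed.

Lemma Lfun_weight p u w (h : #|u|.-tuple R -> R) : (1 <= p)%E ->
  h \in Lfun (leb u) p ->
  (fun t => h t * \prod_(j in w) (1 - coord t j)) \in Lfun (leb u) p.
Proof.
move=> p1; apply: (@Lfun_prod_coord _ _ _ (fun _ x => 1 - x)) => // _.
  exact: measurable_onem.
exact: normr_onem_le1.
Qed.

End weight.

Section real_integral.
Context d (T : measurableType d) (R : realType).
Variable mu : {measure set T -> \bar R}.

Lemma ae_eq_Rintegral (f g : T -> R) :
  measurable_fun setT f -> measurable_fun setT g ->
  {ae mu, forall x, f x = g x} -> \int[mu]_x f x = \int[mu]_x g x.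
Proof.
move=> mf mg fg; congr fine; apply: ae_eq_integral => //.
- exact/measurable_EFinP.
- exact/measurable_EFinP.
- by apply: filterS fg => x ->.
Qed.

Lemma Rintegral_sum (I : Type) (r : seq I) (P : pred I) (f : I -> T -> R) :
  (forall i, P i -> mu.-integrable setT (EFin \o f i)) ->
  \int[mu]_x (\sum_(i <- r | P i) f i x) =
  \sum_(i <- r | P i) \int[mu]_x f i x.
Proof.
(* [Q] carries integrability along with the value, since adding two integrals requires both
   integrands to be integrable. *)
move=> fi; pose Q (g : T -> R) (a : R) :=
  mu.-integrable setT (EFin \o g) /\ \int[mu]_x g x = a.
suff : Q (\sum_(i <- r | P i) f i) (\sum_(i <- r | P i) \int[mu]_x f i x).
  by move=> [_ <-]; apply: eq_Rintegral => x _; rewrite fct_sumE.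
apply: (big_ind2 Q) => [|g a g' a' [ig <-] [ig' <-]|i Pi]; split=> //.
- exact: integrable0.
- by rewrite /Rintegral integral0.
- rewrite (_ : _ \o _ = (EFin \o g) \+ (EFin \o g'))%E//.
  exact: integrableD.
- by rewrite RintegralD.
- exact: fi.
Qed.

Lemma Lfun_sum p (I : Type) (r : seq I) (P : pred I) (f : I -> T -> R) :
  (1 <= p)%E -> (forall i, P i -> f i \in Lfun mu p) ->
  (fun x => \sum_(i <- r | P i) f i x) \in Lfun mu p.
Proof.
move=> p1 fp; rewrite -fct_sumE.
have [L0 LD] := Lfun_addr_closed mu p1.
by apply: (big_ind (fun g => g \in Lfun mu p)).
Qed.

Lemma LfunZ p c (f : T -> R) : (1 <= p)%E -> f \in Lfun mu p ->
  (fun x => c * f x) \in Lfun mu p.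
Proof.
move=> p1 fp; have [L0 LZ] := Lfun_submod_closed mu p1.
rewrite (_ : (fun x => _) = c *: f + 0); first exact: LZ.
by apply/funext => x; rewrite addr0.
Qed.

End real_integral.

Lemma prod_addr_subset (R : comNzRingType) (I : finType) (u : {set I})
    (F G : I -> R) :
  \prod_(j in u) (F j + G j) =
  \sum_(v : {set I} | v \subset u)
    (\prod_(j in v) F j) * \prod_(j in u :\: v) G j.
Proof.
rewrite big_mkcond/=.
(* Outside [u] the factor 1 is written as 0 + 1, so that the product runs over all of [I]; a subset
   [v] not contained in [u] then picks up a factor 0. *)
rewrite (eq_bigr (fun j => (if j \in u then F j else 0) +
   (if j \in u then G j else 1))); last first.
  by move=> j _; case: ifP; rewrite ?add0r.
rewrite bigA_distr (bigID (fun v : {set I} => v \subset u))/=.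
rewrite [X in _ + X]big1 ?addr0; last first.
  move=> v /fintype.subsetPn[j jv ju].
  by rewrite (bigD1 j)//= jv (negbTE ju) mul0r.
apply: eq_bigr => v /fintype.subsetP vu.
rewrite (bigID (mem v))/=; congr (_ * _).
  by apply: eq_bigr => j jv; rewrite jv vu.
rewrite [RHS]big_mkcond [LHS]big_mkcond/=; apply: eq_bigr => j _.
by rewrite inE; case: (j \in v).
Qed.

(** * Change of decomposition *)

Section mixed.
Variables (R : realType) (s : nat) (p : \bar R) (gamma : {set 'I_s} -> R).
Implicit Types (u v w : {set 'I_s}) (c : {set 'I_s} -> R)
  (h : forall u, #|u|.-tuple R -> R).
Hypothesis p1 : (1 <= p)%E.

Notation leb u := (leb_cube R #|u|).
Notation U := (active gamma).

(** The weight is attached before gluing, as part of a function on the whole cube over [u], so that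
    the results on partial integrals apply to it directly. *)
Definition weigh u w (h : #|u|.-tuple R -> R) (t : #|u|.-tuple R) :=
  h t * \prod_(j in w) (1 - coord t j).

Lemma coord_glue_r v w (x : #|v|.-tuple R) (t : #|w|.-tuple R) j :
  w \subset ~: v -> j \in w -> coord (glue x t) j = coord t j.
Proof.
move=> /fintype.subsetP wv jw; rewrite coord_glue ?inE ?jw ?orbT//.
by have := wv _ jw; rewrite inE => /negbTE ->.
Qed.

Lemma coord_glue_l v w (x : #|v|.-tuple R) (t : #|w|.-tuple R) j :
  j \in v -> coord (glue x t) j = coord x j.
Proof. by move=> jv; rewrite coord_glue ?inE ?jv. Qed.

Lemma weigh_glue v w h (x : #|v|.-tuple R) (t : #|w|.-tuple R) :
  w \subset ~: v ->
  weigh w (h (v :|: w)) (glue x t) =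
  h (v :|: w) (glue x t) * \prod_(j in w) (1 - coord t j).
Proof.
move=> wv; congr (_ * _); apply: eq_bigr => j jw.
by rewrite coord_glue_r.
Qed.

Lemma mixedE c h v (x : #|v|.-tuple R) :
  mixed gamma c h x =
  \sum_(w : {set 'I_s} | (w \subset ~: v) && (v :|: w \in U))
    c (v :|: w) * \int[leb w]_t weigh w (h (v :|: w)) (glue x t).
Proof.
apply: eq_bigr => w /andP[wv _]; congr (_ * _).
by apply: eq_Rintegral => t _; rewrite weigh_glue.
Qed.

Lemma Lfun_mixed c h v : (forall u, u \in U -> h u \in Lfun (leb u) p) ->
  @mixed R s gamma c h v \in Lfun (leb v) p.
Proof.
move=> hp; rewrite (funext (@mixedE c h v)); apply: Lfun_sum => // w /andP[wv vwU].
apply: LfunZ => //; apply: (Lfun_Rintegral_glue wv) => //.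
by apply: Lfun_weight => //; exact: hp.
Qed.

(** The [v]-th coefficient sees only the products $c_u h_u$ with $u \supseteq v$. Hence scalars can
    be moved between [c] and [h], and null sets ignored. *)
Lemma ae_eq_mixed c c' h h' v :
  (forall u, u \in U -> h u \in Lfun (leb u) p) ->
  (forall u, u \in U -> h' u \in Lfun (leb u) p) ->
  (forall u, u \in U -> v \subset u ->
     {ae leb u, forall t, c u * h u t = c' u * h' u t}) ->
  {ae leb v, forall x, mixed gamma c h x = mixed gamma c' h' x}.
Proof.
move=> hp hp' hh'.
suff : {ae leb v, forall x, forall w, (w \subset ~: v) && (v :|: w \in U) ->
    c (v :|: w) * \int[leb w]_t weigh w (h (v :|: w)) (glue x t) =
    c' (v :|: w) * \int[leb w]_t weigh w (h' (v :|: w)) (glue x t)}.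
  by apply: filterS => x E; rewrite !mixedE; apply: eq_bigr.
apply: filter_forall => w.
have [/andP[wv vwU]|] := boolP ((w \subset ~: v) && (v :|: w \in U)); last first.
  by move=> _; exact: nearW.
(* The constant is moved under the integral, where the hypothesis on the products applies. *)
have aecZ (c0 : {set 'I_s} -> R) (k : forall u, #|u|.-tuple R -> R) :
    (forall u, u \in U -> k u \in Lfun (leb u) p) ->
    {ae leb v, forall x,
      c0 (v :|: w) * \int[leb w]_t weigh w (k (v :|: w)) (glue x t) =
      \int[leb w]_t weigh w (fun y => c0 (v :|: w) * k (v :|: w) y) (glue x t)}.
  move=> kp.
  have ik : (leb (v :|: w)).-integrable setT (EFin \o weigh w (k (v :|: w))).
    by apply: (Lfun_integrable1 p1); apply: Lfun_weight => //; exact: kp.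
  have aei := ae_integrable_glue wv ik.
  apply: filterS aei => x ix.
  rewrite -RintegralZl//; apply: eq_Rintegral => t _.
  by rewrite /weigh mulrA.
have iZ (c0 : {set 'I_s} -> R) (k : forall u, #|u|.-tuple R -> R) :
    (forall u, u \in U -> k u \in Lfun (leb u) p) ->
    (leb (v :|: w)).-integrable setT
      (EFin \o weigh w (fun y => c0 (v :|: w) * k (v :|: w) y)).
  move=> kp; apply: (Lfun_integrable1 p1); apply: Lfun_weight => //.
  by apply: LfunZ => //; exact: kp.
have E : {ae leb (v :|: w), forall t,
    weigh w (fun y => c (v :|: w) * h (v :|: w) y) t =
    weigh w (fun y => c' (v :|: w) * h' (v :|: w) y) t}.
  by apply: filterS (hh' _ vwU (finset.subsetUl _ _)) => t; rewrite /weigh => ->.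
by apply: filterS3 (aecZ c h hp) (aecZ c' h' hp')
  (ae_eq_Rintegral_glue wv (iZ c h hp) (iZ c' h' hp') E) => x -> -> -> _.
Qed.

End mixed.

Section conversion.
Variables (R : realType) (s : nat) (p : \bar R) (gamma : {set 'I_s} -> R).
Implicit Types (u v w : {set 'I_s}) (c : {set 'I_s} -> R)
  (h : forall u, #|u|.-tuple R -> R).
Hypothesis p1 : (1 <= p)%E.
Hypothesis gamma_down : forall u w : {set 'I_s},
  u \subset w -> 0 < gamma w -> 0 < gamma u.

Notation leb u := (leb_cube R #|u|).
Notation U := (active gamma).

Definition regular_kernel (k : R -> R -> R) :=
  (forall a, measurable_fun setT (k a)) /\
  (forall a x, 0 <= x <= 1 -> `|k a x| <= 1).

Lemma measurable_anchored_kernel a : measurable_fun setT (@anchored_kernel R a).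
Proof. exact: measurable_indic. Qed.

Lemma regular_anchored_kernel : regular_kernel (@anchored_kernel R).
Proof.
split=> [a|a x _]; first exact: measurable_anchored_kernel.
by rewrite /anchored_kernel indicE; case: (_ \in _); rewrite ?normr1// normr0.
Qed.

Lemma regular_anova_kernel : regular_kernel (@anova_kernel R).
Proof.
split=> [a|a x /andP[x0 x1]].
  apply: measurable_funB; first exact: measurable_anchored_kernel.
  exact: measurable_onem.
rewrite /anova_kernel indicE; case: (_ \in _); last first.
  by rewrite sub0r normrN normr_onem_le1 ?x0.
by rewrite opprB addrC subrK ger0_norm.
Qed.

(* [e = 1] turns the anchored coefficients into the ANOVA ones, [e = -1] does
   the converse. As [e ^+ 2 = 1], the sign in front of the [w]-th term is
   [e ^+ #|w|]. *)
Definition signed_mixed (e : R) h v (x : #|v|.-tuple R) : R :=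
  e ^+ #|v| * mixed gamma (fun u => e ^+ #|u|) h x.

(** As [v] and [w] are disjoint, $e^{|v|} e^{|v \cup w|} = e^{2|v|} e^{|w|}$, and the first factor
    is 1. *)
Lemma signed_mixedE (e : R) h v (x : #|v|.-tuple R) : e ^+ 2 = 1 ->
  signed_mixed e h x =
  \sum_(w : {set 'I_s} | (w \subset ~: v) && (v :|: w \in U))
    e ^+ #|w| * \int[leb w]_t weigh w (h (v :|: w)) (glue x t).
Proof.
move=> e2; rewrite /signed_mixed mixedE mulr_sumr.
apply: eq_bigr => w /andP[wv _]; rewrite mulrA; congr (_ * _).
rewrite cardsU (_ : v :&: w = finset.set0) ?cards0 ?subn0.
  by rewrite exprD mulrA -expr2 -exprM mulnC exprM e2 expr1n mul1r.
by apply/eqP; rewrite finset.setIC setI_eq0 -[v]finset.setCK -finset.subsets_disjoint.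
Qed.

Lemma Lfun_signed_mixed e h v : (forall u, u \in U -> h u \in Lfun (leb u) p) ->
  @signed_mixed e h v \in Lfun (leb v) p.
Proof. by move=> hp; apply: LfunZ => //; exact: Lfun_mixed. Qed.

(** One term of the expanded kernel product: by Fubini the coordinates in [w], on which only the
    weight acts, are integrated first. *)
Lemma component_glue (e : R) k v w (h : #|v :|: w|.-tuple R -> R) (x : s.-tuple R) :
  e ^+ 2 = 1 -> regular_kernel k -> w \subset ~: v ->
  h \in Lfun (leb (v :|: w)) p ->
  \int[leb (v :|: w)]_t (h t * (\prod_(j in v) k (tnth x j) (coord t j) *
     \prod_(j in w) (e * (1 - coord t j)))) =
  component k (fun y => e ^+ #|w| * \int[leb w]_t weigh w h (glue y t)) x.
Proof.
move=> e2 [mk k1] wv hp.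
have wp : weigh w h \in Lfun (leb (v :|: w)) p by exact: Lfun_weight.
have kp : (fun t => weigh w h t * \prod_(j in v) k (tnth x j) (coord t j))
    \in Lfun (leb (v :|: w)) p.
  apply: (@Lfun_prod_coord _ _ _ _ _ (fun j => k (tnth x j)) (weigh w h) p1) => // j.
  exact: k1.
pose F t := e ^+ #|w| * (weigh w h t * \prod_(j in v) k (tnth x j) (coord t j)).
have Fp : F \in Lfun (leb (v :|: w)) p by exact: LfunZ.
transitivity (\int[leb (v :|: w)]_t F t).
  by apply: eq_Rintegral => t _; rewrite /F /weigh big_split/= prodr_const; ring.
have iF := Lfun_integrable1 p1 Fp.
rewrite (Rintegral_glue wv iF); apply: ae_eq_Rintegral.
- exact: measurable_Rintegral_glue.
- apply: measurable_funM; last first.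
    by apply: (@measurable_prod_coord _ _ _ _ (fun j => k (tnth x j))) => j; exact: mk.
  apply: measurable_funM => //; apply: measurable_Rintegral_glue => //.
  exact: Lfun_integrable1 p1 wp.
have aei := ae_integrable_glue wv (Lfun_integrable1 p1 wp).
apply: filterS aei => y iy.
rewrite mulrAC -RintegralZl//; apply: eq_Rintegral => t _.
rewrite /F (eq_bigr (fun j => k (tnth x j) (coord y j))); first by ring.
by move=> j jv; rewrite coord_glue_l.
Qed.

Lemma component_signed_mixed (e : R) k k' h (x : s.-tuple R) :
  e ^+ 2 = 1 -> regular_kernel k' ->
  (forall a t, k a t = k' a t + e * (1 - t)) ->
  (forall u, u \in U -> h u \in Lfun (leb u) p) ->
  \sum_(u in U) component k (h u) x =
  \sum_(v in U) component k' (@signed_mixed e h v) x.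
Proof.
move=> e2 rk' kk' hp; have [mk' k1'] := rk'.
pose B u v w : R := \int[leb u]_t (h u t *
  (\prod_(j in v) k' (tnth x j) (coord t j) *
   \prod_(j in w) (e * (1 - coord t j)))).
have e1 : `|e| = 1.
  by apply/eqP; rewrite -(@eqrXn2 _ 2)// -normrX e2 normr1 expr1n.
have -> : \sum_(u in U) component k (h u) x =
    \sum_(u in U) \sum_(v : {set 'I_s} | v \subset u) B u v (u :\: v).
  apply: eq_bigr => u uU; rewrite -Rintegral_sum => [|v vu].
    apply: eq_Rintegral => t _; rewrite -mulr_sumr; congr (_ * _).
    by under eq_bigr do rewrite kk'; exact: prod_addr_subset.
  apply: (Lfun_integrable1 p1).
  rewrite (_ : (fun t => _) = (fun t => (h u t *
      \prod_(j in v) k' (tnth x j) (coord t j)) *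
      \prod_(j in u :\: v) (e * (1 - coord t j)))); last first.
    by apply/funext => t; rewrite mulrA.
  apply: (@Lfun_prod_coord _ _ _ _ _ (fun _ t => e * (1 - t)) _ p1) => //.
  - by move=> _; apply: measurable_funM => //; exact: measurable_onem.
  - by move=> _ t t01; rewrite normrM e1 mul1r normr_onem_le1.
  by apply: (@Lfun_prod_coord _ _ _ _ _ (fun j => k' (tnth x j)) _ p1 _ _
    (hp _ uU)) => // j; exact: k1'.
(* Subsets of active sets are active by [gamma_down], so after the exchange the outer sum again runs
   over [U]. *)
rewrite (exchange_big_dep (mem U))/=; last first.
  move=> u v; rewrite !inE => gu vu; exact: gamma_down gu.
apply: eq_bigr => v vU.
(* Substitution $u = v \cup w$ with $w = u \setminus v$. *)
rewrite (reindex_onto (fun w => v :|: w) (fun u => u :\: v))/=; last first.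
  move=> u /andP[_ /fintype.subsetP vu]; apply/finset.setP => j; rewrite !inE.
  by case: (boolP (j \in v)) => [/vu ->|].
transitivity (\sum_(w : {set 'I_s} | (w \subset ~: v) && (v :|: w \in U))
   component k' (fun y => e ^+ #|w| *
     \int[leb w]_t weigh w (h (v :|: w)) (glue y t)) x).
  have wvE w : (w \subset ~: v) = ((v :|: w) :\: v == w).
    rewrite finset.setDUl finset.setDv finset.set0U.
    by rewrite -finset.disjoints_subset (sameP eqP finset.setDidPl).
  apply: eq_big => [w|w /andP[/andP[vwU _]]].
    by rewrite finset.subsetUl andbT andbC wvE.
  rewrite -wvE => wv; rewrite (eqP (etrans (esym (wvE w)) wv)).
  by apply: component_glue => //; exact: hp.
rewrite -Rintegral_sum.
  by apply: eq_Rintegral => y _; rewrite -mulr_suml signed_mixedE.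
move=> w /andP[wv vwU]; apply: (Lfun_integrable1 p1).
apply: (@Lfun_prod_coord _ _ _ _ _ (fun j => k' (tnth x j)) _ p1) => //.
  by move=> j; exact: k1'.
apply: LfunZ => //; apply: (Lfun_Rintegral_glue wv) => //.
by apply: Lfun_weight => //; exact: hp.
Qed.

End conversion.

(** * Uniqueness of the decompositions *)

Section anchored_uniqueness.
Variables (R : realType) (s : nat) (p : \bar R) (gamma : {set 'I_s} -> R).
Implicit Types (u v w : {set 'I_s}) (h : forall u, #|u|.-tuple R -> R).
Hypothesis p1 : (1 <= p)%E.

Notation leb u := (leb_cube R #|u|).
Notation U := (active gamma).

(* The value [+oo] makes [setT] a ray. *)
Definition rays : set (set R) :=
  [set A | exists a : \bar R, A = [set y | (y%:E < a)%E]].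

Lemma setI_closed_rays : setI_closed rays.
Proof.
move=> _ _ [a ->] [b ->]; exists (Order.min a b); apply/seteqP.
by split=> y /=; rewrite lt_min => /andP.
Qed.

Lemma measurable_raysE : @measurable _ R = <<s rays >>.
Proof.
apply/seteqP; split.
  rewrite (_ : measurable = <<s @RGenInftyO.G R >>).
    by apply: sub_sigma_algebra2 => _ [r ->]; exists r%:E; apply/seteqP;
      split=> y /=; rewrite in_itv/= lte_fin.
  exact: RGenInftyO.measurableE.
apply: smallest_sub; first exact: sigma_algebra_measurable.
move=> _ [a ->]; rewrite -[X in measurable X]setTI.
apply: (measurable_lte (T := R)) => //.
Qed.

(** Moves the end of a ray into $[0,1]$ without changing the part of the ray in $[0,1)$; the result
    can then serve as a coordinate of a point of the cube. *)
Definition clamp (a : \bar R) : R :=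
  match a with r%:E => Num.max 0 (Num.min r 1) | +oo%E => 1 | -oo%E => 0 end.

Lemma clamp_itv a : 0 <= clamp a <= 1.
Proof.
case: a => [r||]; rewrite /= ?lexx ?ler01//.
by rewrite le_max lexx/= ge_max ler01 ge_min lexx orbT.
Qed.

Lemma lt_clamp a (y : R) : 0 <= y < 1 ->
  (y%:E < a)%E = (y \in `[0, clamp a[).
Proof.
move=> /andP[y0 y1]; rewrite in_itv/= y0/=.
case: a => [r||]/=; rewrite ?lte_fin.
- by rewrite lt_max (ltNge y 0) y0/= lt_min y1 andbT.
- by rewrite ltry y1.
- by rewrite (ltNge y 0) y0.
Qed.

(** The values of the component are the integrals of [g] over boxes anchored at 0. These boxes form
    a generating pi-system, so [g] integrates to 0 over every measurable set. *)
Lemma anchored_integral_ae0 u (g : #|u|.-tuple R -> R) :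
  (leb u).-integrable setT (EFin \o g) ->
  (forall x, cube R s x -> component (@anchored_kernel R) g x = 0) ->
  {ae leb u, forall t, g t = 0}.
Proof.
move=> ig g0; have mg : measurable_fun setT g.
  by apply/measurable_EFinP; exact: measurable_int ig.
have box0 (X : set (#|u|.-tuple R)) : boxes rays X ->
    (\int[leb u]_(t in X) (g t)%:E = 0)%E.
  move=> [A /choice[a Aa] ->].
  have mA : measurable (box A).
    apply: measurable_box => i; rewrite measurable_raysE Aa.
    by apply: sub_sigma_algebra; exists (a i).
  (* The corner of the box cut out by the rays; coordinates outside [u] do not enter the component
     and are set to 0. *)
  pose x := [tuple if [pick i : 'I_#|u| | enum_val i == j] is Some i
    then clamp (a i) else 0 | j < s].
  have xE i : tnth x (enum_val i) = clamp (a i).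
    rewrite tnth_mktuple; case: pickP => [k /eqP/enum_val_inj -> //|/(_ i)].
    by rewrite eqxx.
  have cx : cube R s x.
    move=> j; rewrite tnth_mktuple; case: pickP => [i _|_].
      exact: clamp_itv.
    by rewrite lexx ler01.
  have gp : (fun t => g t * \prod_(j in u) @anchored_kernel R (tnth x j) (coord t j))
      \in Lfun (leb u) 1.
    apply: (@Lfun_prod_coord _ _ _ _ _ (fun j => @anchored_kernel R (tnth x j)) _ _ _ _
      ((Lfun1_integrable _ _).2 ig)) => //.
      by move=> j; exact: measurable_anchored_kernel.
    by move=> j; exact: (regular_anchored_kernel R).2.
  have igp := (Lfun1_integrable _ _).1 gp.
  rewrite integral_mkcond -[RHS]/((0 : R)%:E) -(g0 _ cx) /component /Rintegral.
  rewrite fineK ?integrable_fin_num//; apply: ae_eq_integral => //.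
  - apply: (measurable_restrictT _ mA).1; apply/measurable_EFinP.
    exact: measurable_funTS.
  - exact: measurable_int igp.
  apply: filterS (ae_coord_itv R u) => t t01 _.
  rewrite patchE (_ : (t \in box A) = [forall i, coord t (enum_val i) \in `[0, clamp (a i)[]).
    case: ifPn => [/forallP tx|/forallPn[i ti]].
      rewrite big1 ?mulr1// => j ju.
      rewrite /anchored_kernel -(enum_rankK_in ju ju) xE indicE mem_set//.
      exact: tx.
    rewrite (bigD1 (enum_val i)) ?enum_valP//= /anchored_kernel indicE memNset.
      by rewrite mul0r mulr0.
    by rewrite xE; apply/negP.
  apply/idP/forallP => [/set_mem At i|tx].
    by rewrite -lt_clamp//; have := At i; rewrite Aa -coord_enum_val.
  by apply/mem_set => i; rewrite Aa/= -coord_enum_val lt_clamp.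
have all0 (X : set (#|u|.-tuple R)) : measurable X ->
    (\int[leb u]_(t in X) (g t)%:E = 0)%E.
  have mE := measurable_boxesE #|u| measurable_raysE.
  have raysT : rays setT by exists +oo%E; apply/seteqP; split=> y//= _; rewrite ltry.
  have P0 : (\int[leb u]_(t in setT) (g t)%:E = 0)%E.
    by apply: box0; exists (fun=> setT) => //; apply/seteqP.
  rewrite (mE raysT); move: X; apply: dynkin_induction => //.
  - exact: mE.
  - exact/setI_closed_boxes/setI_closed_rays.
  (* Complements: the whole space is itself a box of rays, so the integral over it vanishes by
     [P0]. *)
  - move=> S mS S0.
    have := P0; rewrite -(setvU S) setUC integral_setU_EFin//; last 2 first.
      exact: measurable_funTS.
      by apply/disj_setPS => t [].
    by rewrite S0 add0e.
    exact: measurableC.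
  - move=> F mF tF F0; rewrite integral_bigcup//.
      by rewrite eseries0.
    apply: integrableS ig => //; exact: bigcup_measurable.
have : ae_eq (leb u) setT (EFin \o g) (cst 0%E).
  apply: integral_ae_eq => // E _ mE.
  by rewrite integral0; exact: all0.
by apply: filterS => t /(_ I) [].
Qed.

Lemma component_anchored0 u (g : #|u|.-tuple R -> R) (x : s.-tuple R) j :
  j \in u -> tnth x j = 0 -> component (@anchored_kernel R) g x = 0.
Proof.
move=> ju xj; rewrite /component (@eq_Rintegral _ _ _ _ setT (fun=> 0)).
  by rewrite /Rintegral integral0.
move=> t _; rewrite (bigD1 j)//= xj /anchored_kernel indicE memNset ?mul0r ?mulr0//.
by rewrite /= in_itv/=; apply/negP; rewrite negb_and; case: ltP; rewrite ?orbT.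
Qed.

Lemma anchored_null h : (forall u, u \in U -> h u \in Lfun (leb u) p) ->
  (forall x, cube R s x ->
     \sum_(u in U) component (@anchored_kernel R) (h u) x = 0) ->
  forall u, u \in U -> {ae leb u, forall t, h u t = 0}.
Proof.
move=> hp sum0 u uU; apply: anchored_integral_ae0.
  exact: Lfun_integrable1 p1 (hp u uU).
(* Strong induction on the cardinality, for the vanishing of the [u]-th component at every point of
   the cube. *)
have [n] := ubnP #|u|; elim: n u uU => // n ih u uU un x cx.
(* At [x'] every component not indexed by a subset of [u] vanishes because $[0,0)$ is empty; proper
   subsets vanish by induction, and the [u]-th component is the same as at [x]. *)
pose x' := [tuple if j \in u then tnth x j else 0 | j < s].
have cx' : cube R s x'.
  by move=> j; rewrite tnth_mktuple; case: ifP => _; [exact: cx|rewrite lexx ler01].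
have := sum0 _ cx'; rewrite (bigD1 u)//= big1 => [|v /andP[vU vu]].
  rewrite addr0 => <-; apply: eq_Rintegral => t _; congr (_ * _).
  by apply: eq_bigr => j ju; rewrite tnth_mktuple ju.
have [vsu|/fintype.subsetPn[j jv ju]] := boolP (v \subset u); last first.
  by apply: (component_anchored0 _ jv); rewrite tnth_mktuple (negbTE ju).
apply: ih => //; rewrite -ltnS; apply: leq_trans un; rewrite ltnS proper_card//.
by rewrite finset.properEneq vu.
Qed.

End anchored_uniqueness.

Section uniqueness.
Variables (R : realType) (s : nat) (p : \bar R) (gamma : {set 'I_s} -> R).
Implicit Types (u v w : {set 'I_s}) (c : {set 'I_s} -> R)
  (h : forall u, #|u|.-tuple R -> R).
Hypothesis p1 : (1 <= p)%E.
Hypothesis gamma_down : forall u w : {set 'I_s},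
  u \subset w -> 0 < gamma w -> 0 < gamma u.

Notation leb u := (leb_cube R #|u|).
Notation U := (active gamma).

(** Uniqueness in linear form: the zero function has only the null decomposition. The general case
    follows by taking differences. *)
Definition faithful_kernel (k : R -> R -> R) := forall h,
  (forall u, u \in U -> h u \in Lfun (leb u) p) ->
  (forall x, cube R s x -> \sum_(u in U) component k (h u) x = 0) ->
  forall u, u \in U -> {ae leb u, forall t, h u t = 0}.

Lemma faithful_anchored_kernel : faithful_kernel (@anchored_kernel R).
Proof. by move=> h; exact: anchored_null. Qed.

(** Every term with [w] nonempty evaluates [h] at a proper superset of [v], so only the term of the
    empty set remains. *)
Lemma mixed_concentrated c h v (x : #|v|.-tuple R) : v \in U ->
  (forall u, v \proper u -> h u = (fun=> 0)) ->
  mixed gamma c h x = c v * h v x.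
Proof.
move=> vU h0; rewrite mixedE (bigD1 finset.set0)/=; last first.
  by rewrite finset.setU0 finset.sub0set.
rewrite big1 ?addr0 => [|w /andP[/andP[wv vwU] w0]]; last first.
  rewrite h0; first by rewrite /weigh (@eq_Rintegral _ _ _ _ setT (fun=> 0))
    ?/Rintegral ?integral0 ?mulr0// => t _; rewrite mul0r.
  rewrite finset.properEneq finset.subsetUl andbT; apply: contra w0 => /eqP vE.
  rewrite -finset.subset0 -(finset.setICr v) finset.subsetI wv andbT vE.
  exact: finset.subsetUr.
(* The integral over the zero-dimensional cube is evaluation. The types of tuples over [v :|: set0]
   and [v] differ, hence the use of [eq_coord_fun]. *)
rewrite [X in c X](finset.setU0 v); congr (_ * _).
rewrite (@eq_Rintegral _ _ _ _ setT (fun=> h v x)) => [|t _].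
  by rewrite Rintegral_cst// measure_probT mulr1.
rewrite /weigh big_set0 mulr1; apply: (eq_coord_fun h) => [|j].
  exact: finset.setU0.
by rewrite inE finset.in_set0 orbF => jv; rewrite coord_glue_l.
Qed.

(* Downward induction: if the coefficients of all proper supersets of [v]
   vanish, the [v]-th transformed coefficient is the [v]-th original one. *)
Lemma mixed_inj e h : e ^+ 2 = 1 ->
  (forall u, u \in U -> h u \in Lfun (leb u) p) ->
  (forall v, v \in U -> {ae leb v, forall x, @signed_mixed _ _ gamma e h v x = 0}) ->
  forall u, u \in U -> {ae leb u, forall t, h u t = 0}.
Proof.
move=> e2 hp sm0 v vU.
have [n] := ubnP (s - #|v|)%N; elim: n v vU => // n ih v vU vn.
(* [h'] keeps only the [v]-th coefficient; by induction it agrees almost everywhere with [h] on all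
   active supersets of [v]. *)
pose h' u : #|u|.-tuple R -> R := if u == v then h u else fun=> 0.
have hp' u : u \in U -> h' u \in Lfun (leb u) p.
  move=> uU; rewrite /h'; case: ifP => _; first exact: hp.
  exact: (Lfun_addr_closed (leb u) p1).1.
have E : {ae leb v, forall x, mixed gamma (fun u => e ^+ #|u|) h x =
    mixed gamma (fun u => e ^+ #|u|) h' x}.
  apply: (ae_eq_mixed p1) => // u uU vu; rewrite /h'.
  have [_|uv] := eqVneq u v; first exact: nearW.
  have vpu : v \proper u by rewrite finset.properEneq eq_sym uv.
  apply: filterS (ih u uU _) => [t ->//|].
  rewrite -ltnS; apply: leq_trans vn; rewrite ltnS ltn_sub2l ?proper_card//.
  by rewrite (leq_trans (proper_card vpu))// -[leqRHS]card_ord max_card.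
apply: filterS2 E (sm0 v vU) => x; rewrite /signed_mixed => ->.
rewrite (@mixed_concentrated _ _ v)//; last first.
  by move=> u /proper_neq; rewrite /h' eq_sym => /negbTE ->.
by rewrite /h' eqxx mulrA -expr2 -exprM mulnC exprM e2 expr1n mul1r.
Qed.

Lemma anova_kernelE (a t : R) :
  anova_kernel a t = anchored_kernel a t + -1 * (1 - t).
Proof. by rewrite mulN1r. Qed.

Lemma anchored_kernelE (a t : R) :
  anchored_kernel a t = anova_kernel a t + 1 * (1 - t).
Proof. by rewrite mul1r subrK. Qed.

Lemma faithful_anova_kernel : faithful_kernel (@anova_kernel R).
Proof.
move=> h hp h0; have e2 : (-1) ^+ 2 = 1 :> R by rewrite sqrrN expr1n.
apply: (mixed_inj e2) => // v vU.
apply: (faithful_anchored_kernel (h := fun v => @signed_mixed _ _ gamma (-1) h v)) => //.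
  by move=> u _; exact: Lfun_signed_mixed.
move=> x cx; rewrite -(component_signed_mixed p1 gamma_down x e2
  (regular_anchored_kernel R) anova_kernelE hp).
exact: h0.
Qed.

Lemma componentB k u (g g' : #|u|.-tuple R -> R) (x : s.-tuple R) :
  regular_kernel k -> g \in Lfun (leb u) p -> g' \in Lfun (leb u) p ->
  component k (fun t => g t - g' t) x = component k g x - component k g' x.
Proof.
move=> [mk k1] gp gp'.
have igk f : f \in Lfun (leb u) p -> (leb u).-integrable setT
    (EFin \o (fun t => f t * \prod_(j in u) k (tnth x j) (coord t j))).
  move=> fp; apply: (Lfun_integrable1 p1).
  by apply: (@Lfun_prod_coord _ _ _ _ _ (fun j => k (tnth x j)) _ p1) => // j; exact: k1.
rewrite /component -RintegralB//; [|exact: igk..].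
by apply: eq_Rintegral => t _; rewrite mulrBl.
Qed.

Lemma decomposition_unique k f h h' : regular_kernel k -> faithful_kernel k ->
  decomposition p gamma k f h -> decomposition p gamma k f h' ->
  forall u, u \in U -> {ae leb u, forall t, h u t = h' u t}.
Proof.
move=> rk fk [hp fh] [hp' fh'] u uU.
have : {ae leb u, forall t, h u t - h' u t = 0}.
  apply: (fk (fun u t => h u t - h' u t)) uU.
    move=> v vU; rewrite (_ : (fun t => _) = -1 *: h' v + h v); last first.
      by apply/funext => t; rewrite scaleN1r addrC.
    by apply: (Lfun_submod_closed (leb v) p1).2; [exact: hp'|exact: hp].
  move=> x cx; under eq_bigr do rewrite componentB ?hp ?hp'//.
  by rewrite sumrB -fh// -fh'// subrr.
by apply: filterS => t /eqP; rewrite subr_eq0 => /eqP.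
Qed.

Lemma eq_weighted_lp_norm (N N' : {set 'I_s} -> \bar R) :
  {in U, N =1 N'} -> weighted_lp_norm p gamma N = weighted_lp_norm p gamma N'.
Proof.
move=> NN'; rewrite /weighted_lp_norm; case: p => [r||//].
  by congr (_ `^ _)%E; apply: eq_bigr => u uU; rewrite NN'.
by apply: eq_bigr => u uU; rewrite NN'.
Qed.

(** The value chosen by [xget] is independent of the decomposition, since two decompositions agree
    almost everywhere. *)
Lemma space_normE k f h : regular_kernel k -> faithful_kernel k ->
  decomposition p gamma k f h ->
  space_norm p gamma k f = weighted_lp_norm p gamma (fun u => Lp_norm p (h u)).
Proof.
move=> rk fk fh; rewrite /space_norm; apply: xget_unique; first by exists h.
move=> _ [h' fh' <-]; apply: eq_weighted_lp_norm => u uU.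
have [hp _] := fh; have [hp' _] := fh'.
apply: ae_eq_Lnorm => //.
- by have [] := (Lfun_normP _ _ _).1 (hp' _ uU).
- by have [] := (Lfun_normP _ _ _).1 (hp _ uU).
exact: decomposition_unique fh' fh u uU.
Qed.

End uniqueness.

Section Lnorm_scale.
Context d (T : measurableType d) (R : realType).
Variable P : probability T R.
Implicit Types (f g : T -> R) (p : \bar R).
Local Open Scope ereal_scope.

Lemma Lnorm_scale p a f : 1 <= p -> f \in Lfun P p ->
  'N[P]_p[EFin \o (fun x => a * f x)%R] = `|a|%:E * 'N[P]_p[EFin \o f].
Proof. by move=> p1 fp; rewrite -(LnormZ (Lfun_Sub p1 fp)). Qed.

Lemma Lnorm_cst p a : 1 <= p -> 'N[P]_p[EFin \o cst a] = `|a|%:E.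
Proof.
rewrite unlock; case: p => [r|_|//]; last first.
  by rewrite measure_probT lte01 (_ : _ \o _ = cst `|a|%:E)// ess_sup_cst// measure_probT.
rewrite lee_fin => r1; rewrite (eq_integral (cst (`|a| `^ r)%:E))//.
rewrite integral_cst// measure_probT mule1 poweR_EFin -powRrM mulfV ?powRr1//.
by rewrite gt_eqF// (lt_le_trans ltr01).
Qed.

Lemma Lfun_cst_prob p a : 1 <= p -> cst a \in Lfun P p.
Proof.
move=> p1; apply/Lfun_normP; split; first exact: measurable_cst.
by rewrite Lnorm_cst// ltry.
Qed.

End Lnorm_scale.

(** * Embedding norms *)

Section embedding.
Variables (R : realType) (s : nat) (p : \bar R) (gamma : {set 'I_s} -> R).
Implicit Types (u v w : {set 'I_s}) (c : {set 'I_s} -> R)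
  (h : forall u, #|u|.-tuple R -> R).
Hypothesis p1 : (1 <= p)%E.
Hypothesis gamma_down : forall u w : {set 'I_s},
  u \subset w -> 0 < gamma w -> 0 < gamma u.

Notation leb u := (leb_cube R #|u|).
Notation U := (active gamma).

(** For coefficients of norm $c_u \gamma_u$ the weights cancel; this produces the denominator of the
    quotients. *)
Lemma weighted_lp_norm_scale c : (forall u, u \in U -> 0 <= c u) ->
  weighted_lp_norm p gamma (fun u => (c u * gamma u)%:E) = lp_norm p gamma c.
Proof.
move=> c0; rewrite /weighted_lp_norm /lp_norm; case: p => [r||//].
  congr (_ `^ _)%E; apply: eq_bigr => u uU.
  have gu : 0 < gamma u by move: uU; rewrite inE.
  rewrite -EFinM powRM ?c0// ?(ltW gu)// mulrCA -powRD ?addNr ?powRr0 ?mulr1//.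
  by rewrite (gt_eqF gu) implybT.
apply: eq_bigr => u uU; have gu : 0 < gamma u by move: uU; rewrite inE.
by rewrite -EFinM mulrCA mulVf ?mulr1// gt_eqF.
Qed.

Lemma Lp_norm_signed_mixed (e : R) h v : e ^+ 2 = 1 ->
  (forall u, u \in U -> h u \in Lfun (leb u) p) ->
  Lp_norm p (@signed_mixed _ _ gamma e h v) =
  Lp_norm p (@mixed _ _ gamma (fun u => e ^+ #|u|)%R h v).
Proof.
move=> e2 hp; rewrite /Lp_norm /signed_mixed Lnorm_scale//; last exact: Lfun_mixed.
have e1 : `|e| = 1.
  by apply/eqP; rewrite -(@eqrXn2 _ 2)// -normrX e2 normr1 expr1n.
by rewrite normrX e1 expr1n mul1e.
Qed.

Lemma ae0_Lp_norm u (g : #|u|.-tuple R -> R) : g \in Lfun (leb u) p ->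
  Lp_norm p g = 0%E -> {ae leb u, forall t, g t = 0}.
Proof.
move=> /Lfun_normP[mg _] /Lnorm_eq0_eq0 g0.
have : ae_eq (leb u) setT (EFin \o g) (cst 0%E).
  by apply: g0; [exact/measurable_EFinP|exact: lt_le_trans p1].
by apply: filterS => t /(_ I) [].
Qed.

Definition mixed_ratios : set (\bar R) := [set q : \bar R | exists c h,
  [/\ forall u, u \in U -> 0 <= c u,
      exists2 u, u \in U & c u != 0,
      forall u, u \in U -> h u \in Lfun (leb_cube R #|u|) p,
      forall u, u \in U -> Lp_norm p (h u) = (gamma u)%:E
    & q = (weighted_lp_norm p gamma
             (fun v => Lp_norm p (@mixed R s gamma c h v)) /
           lp_norm p gamma c)%E]].

(** The two sets of quotients coincide, not only their suprema. The parameter [e] disappears because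
    the signs are absorbed into the [h u], which does not affect their norms. *)
Lemma embedding_normE k k' (e : R) : e ^+ 2 = 1 ->
  regular_kernel k -> regular_kernel k' ->
  faithful_kernel p gamma k -> faithful_kernel p gamma k' ->
  (forall a t, k a t = k' a t + e * (1 - t)) ->
  embedding_norm p gamma k k' =
  ereal_sup mixed_ratios.
Proof.
move=> e2 rk rk' fk fk' kk'.
have esq n : e ^+ n * e ^+ n = 1 by rewrite -expr2 -exprM mulnC exprM e2 expr1n.
have convert f h : decomposition p gamma k f h ->
    decomposition p gamma k' f (fun v => @signed_mixed _ _ gamma e h v).
  move=> [hp fh]; split=> [u uU|x cx]; first exact: Lfun_signed_mixed.
  by rewrite fh//; exact: (component_signed_mixed p1 gamma_down x e2 rk' kk' hp).
have ratioE f h : decomposition p gamma k f h ->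
    (space_norm p gamma k' f / space_norm p gamma k f)%E =
    (weighted_lp_norm p gamma (fun v =>
       Lp_norm p (@mixed _ _ gamma (fun u => e ^+ #|u|)%R h v)) /
     weighted_lp_norm p gamma (fun u => Lp_norm p (h u)))%E.
  move=> fh; rewrite (space_normE p1 rk fk fh) (space_normE p1 rk' fk' (convert _ _ fh)).
  congr (_ / _)%E; apply: eq_weighted_lp_norm => v _.
  exact: Lp_norm_signed_mixed e2 fh.1.
rewrite /embedding_norm; congr ereal_sup; apply/seteqP; split => q.
- move=> [f [[h fh] [x cx fx0]] <-]; have [hp fE] := fh.
  have Nfin u : u \in U -> Lp_norm p (h u) \is a fin_num.
    move=> uU; have [_ Nh] := (Lfun_normP _ _ _).1 (hp _ uU).
    by rewrite ge0_fin_numE//; exact: Lnorm_ge0.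
  have gU u : u \in U -> 0 < gamma u by rewrite inE.
  (* [c u] is chosen so that dividing by it leaves norm [gamma u]. If [c u = 0], then [h u] is null
     and the constant [gamma u] is a filler of the prescribed norm. *)
  pose c u := fine (Lp_norm p (h u)) / gamma u.
  pose h' u := if c u == 0 then cst (gamma u)
               else fun t => (e ^+ #|u| / c u) * h u t.
  have c0 u : u \in U -> 0 <= c u.
    by move=> uU; rewrite divr_ge0 ?(ltW (gU _ uU))// fine_ge0// Lnorm_ge0.
  have NE u : u \in U -> Lp_norm p (h u) = (c u * gamma u)%:E.
    by move=> uU; rewrite /c divfK ?gt_eqF ?gU// fineK// Nfin.
  have hp' u : u \in U -> h' u \in Lfun (leb u) p.
    move=> uU; rewrite /h'; case: ifP => _; first exact: Lfun_cst_prob.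
    by apply: LfunZ => //; exact: hp.
  have cae u : u \in U -> c u = 0 -> {ae leb u, forall t, h u t = 0}.
    move=> uU cu; apply: ae0_Lp_norm; first exact: hp.
    by rewrite NE// cu mul0r.
  exists c, h'; split=> //.
  + have [/exists_inP[u uU cu]|/exists_inPn cU] := boolP [exists u in U, c u != 0].
      by exists u.
    (* If all [c u] were 0, all coefficients would be null and [f] would vanish on the cube. *)
    case/negP: fx0; rewrite fE// big1// => u uU.
    have cu : c u = 0 by have := cU u uU; rewrite negbK => /eqP.
    rewrite /component; have [mk k1] := rk.
    have mh : measurable_fun setT (h u) by have [] := (Lfun_normP _ _ _).1 (hp _ uU).
    rewrite (ae_eq_Rintegral (g := fun=> 0)) ?/Rintegral ?integral0//.
      apply: measurable_funM => //.
      by apply: (@measurable_prod_coord _ _ _ _ (fun j => k (tnth x j))) => j; exact: mk.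
    by apply: filterS (cae u uU cu) => t ->; rewrite mul0r.
  + move=> u uU; rewrite /h'; have [cu|cu] := eqVneq (c u) 0.
      by rewrite /Lp_norm Lnorm_cst// gtr0_norm// gU.
    rewrite /Lp_norm Lnorm_scale ?hp// -/(Lp_norm p (h u)) NE// -EFinM.
    have e1 : `|e| = 1.
      by apply/eqP; rewrite -(@eqrXn2 _ 2)// -normrX e2 normr1 expr1n.
    rewrite normrM normrX e1 expr1n mul1r normfV (ger0_norm (c0 _ uU)).
    by rewrite mulrA mulVf// mul1r.
  rewrite (ratioE _ _ fh); congr (_ / _)%E.
    apply: eq_weighted_lp_norm => v _; apply: ae_eq_Lnorm => //.
    - by have [] := (Lfun_normP _ _ _).1 (Lfun_mixed p1 (fun u => e ^+ #|u|) v hp).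
    - by have [] := (Lfun_normP _ _ _).1 (Lfun_mixed p1 c v hp').
    apply: (ae_eq_mixed p1) => // u uU _; rewrite /h'.
    have [cu|cu] := eqVneq (c u) 0.
      by apply: filterS (cae u uU cu) => t ->; rewrite cu mul0r mulr0.
    by apply: nearW => t; rewrite mulrA mulrCA divff// mulr1.
  by rewrite -weighted_lp_norm_scale//; apply: eq_weighted_lp_norm => u /NE.
- move=> [c [h [c0 [u0 u0U cu0] hp hg ->]]].
  (* The factor [e ^+ #|u|] cancels the one inside [signed_mixed], leaving [mixed] with the
     coefficients [c]. *)
  pose h1 u t := (e ^+ #|u| * c u) * h u t.
  have hp1 u : u \in U -> h1 u \in Lfun (leb u) p.
    by move=> uU; apply: LfunZ => //; exact: hp.
  have e1 : `|e| = 1.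
    by apply/eqP; rewrite -(@eqrXn2 _ 2)// -normrX e2 normr1 expr1n.
  have NE u : u \in U -> Lp_norm p (h1 u) = (c u * gamma u)%:E.
    move=> uU; rewrite /Lp_norm Lnorm_scale ?hp// -/(Lp_norm p (h u)) hg// -EFinM.
    by rewrite normrM normrX e1 expr1n mul1r ger0_norm ?c0.
  pose f x := \sum_(u in U) component k (h1 u) x.
  have fh1 : decomposition p gamma k f h1 by split.
  exists f.
    split; first by exists h1.
    (* If [f] vanished on the cube, faithfulness would make [h1 u0] null, but its norm is
       $c_{u_0}\gamma_{u_0} > 0$. *)
    apply: contrapT => fx0; have f0 x : cube R s x -> f x = 0.
      by move=> cx; apply/eqP; apply: contrapT => /negP fx; apply: fx0; exists x.
    have := NE _ u0U; rewrite /Lp_norm (ae_eq_Lnorm (g := cst 0)) ?Lnorm_cst//.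
    + rewrite normr0 => -[] /esym/eqP; rewrite mulf_eq0 (negbTE cu0)/=.
      by rewrite gt_eqF//; move: u0U; rewrite inE.
    + by have [] := (Lfun_normP _ _ _).1 (hp1 _ u0U).
    + exact: fk hp1 f0 u0 u0U.
  rewrite (ratioE _ _ fh1); congr (_ / _)%E.
    apply: eq_weighted_lp_norm => v _; apply: ae_eq_Lnorm => //.
    - by have [] := (Lfun_normP _ _ _).1 (Lfun_mixed p1 (fun u => e ^+ #|u|) v hp1).
    - by have [] := (Lfun_normP _ _ _).1 (Lfun_mixed p1 c v hp).
    apply: (ae_eq_mixed p1) => // u uU _; apply: nearW => t.
    by rewrite /h1 !mulrA esq mul1r.
  by rewrite -weighted_lp_norm_scale//; apply: eq_weighted_lp_norm => u /NE.
Qed.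

End embedding.

(** * Integrals of powers and of product functions *)

Section power_integral.
Variable R : realType.
Notation mu := (@lebesgue_measure R).
Import numFieldNormedType.Exports.

Lemma continuous_powR_gt0 (b x : R) : 0 < x -> {for x, continuous (@powR R ^~ b)}.
Proof.
move=> x0; apply: differentiable_continuous; apply/derivable1_diffP.
by apply: derivable_powR; rewrite in_itv/= x0.
Qed.

Lemma cvg_powR_at_right0 (b : R) : 0 <= b ->
  x `^ b @[x --> (0 : R)^'+] --> (0 : R) `^ b.
Proof.
rewrite le_eqVlt => /predU1P[<-|b0].
  by under eq_fun do rewrite powRr0; rewrite powRr0; exact: cvg_cst.
by rewrite powR0 ?gt_eqF//; exact: powR_cvg0.
Qed.

Lemma continuous_powR01 (b : R) : 0 <= b ->
  {within `[0, 1], continuous (@powR R ^~ b)}.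
Proof.
move=> b0; apply/continuous_within_itvP => //; split.
- by move=> x; rewrite in_itv/= => /andP[x0 _]; exact: continuous_powR_gt0.
- exact: cvg_powR_at_right0.
- by apply: cvg_at_left_filter; exact: continuous_powR_gt0.
Qed.

Lemma integral_powR01 (b : R) : 0 <= b ->
  (\int[mu]_(x in `[0%R, 1%R]) (x `^ b)%:E = ((b + 1)^-1)%:E)%E.
Proof.
move=> b0; have b1 : 0 < b + 1 by rewrite ltr_wpDl.
rewrite (@continuous_FTC2 _ _ (fun x => (b + 1)^-1 * x `^ (b + 1)))//.
- by rewrite powR1 powR0 ?gt_eqF// mulr0 mulr1 sube0.
- exact: continuous_powR01.
- split.
  + move=> x; rewrite in_itv/= => /andP[x0 _].
    by apply: derivableM => //; apply: derivable_powR; rewrite in_itv/= x0.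
  + apply: cvgM; first exact: cvg_cst.
    exact: cvg_powR_at_right0 (ltW b1).
  + apply: cvg_at_left_filter; apply: cvgM; first exact: cvg_cst.
    exact: continuous_powR_gt0.
- move=> x; rewrite in_itv/= => /andP[x0 _].
  have x0' : x \in `]0, +oo[ by rewrite in_itv/= x0.
  rewrite derive1Ml; last exact: derivable_powR.
  by rewrite powR_derive1// addrK mulrA mulVf ?mul1r// gt_eqF.
Qed.

(* [leb01] lives on [R] with its default measurable structure, and
   [lebesgue_measure] on the isomorphic [measurableTypeR R]. *)
Lemma ge0_integral_leb01 (f : R -> \bar R) :
  measurable_fun setT f -> (forall x, 0 <= f x)%E ->
  (\int[@leb01 R]_x f x = \int[mu]_(x in `[0%R, 1%R]) f x)%E.
Proof.
move=> mf f0.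
have D0 : leb01 (~` `[(0 : R), 1]) = 0%E.
  by rewrite /leb01 /mrestr setICl measure0.
have mD : measurable (~` `[(0 : R), 1]%classic) by exact: measurableC.
rewrite (ge0_negligible_integral mD _ _ _ D0)//.
rewrite setTD setCK.
pose i (x : measurableTypeR R) : R := x.
have mi : measurable_fun setT i by move=> _ A mA; rewrite setTI.
rewrite (eq_measure_integral (pushforward mu i))//.
  by rewrite ge0_integral_pushforward//; exact: measurable_funTS.
by move=> A mA AD; rewrite /= /leb01 /mrestr setIidl.
Qed.

(** Substitution of $1-x$ for $x$. The absolute value keeps the base non-negative off $[0,1]$ and
    changes nothing on it. *)
Lemma integral_leb01_powR (b : R) : 0 <= b ->
  (\int[@leb01 R]_x (`|1 - x| `^ b)%:E = ((b + 1)^-1)%:E)%E.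
Proof.
move=> b0; rewrite ge0_integral_leb01; last 2 first.
- apply/measurable_EFinP; apply: (measurableT_comp (measurable_powR b)).
  by apply: measurableT_comp => //; exact: measurable_onem.
- by move=> x; rewrite lee_fin powR_ge0.
rewrite -integral_powR01// [RHS](integration_by_substitution_onem (r := 1))//.
- rewrite unstable.onem1; apply: eq_integral => x; rewrite inE/= in_itv/= => /andP[_ x1].
  by rewrite ger0_norm ?subr_ge0// /unstable.onem.
- by rewrite ler01 lexx.
- exact: continuous_powR01.
Qed.

Lemma integral_prod_tnth n (F : R -> R) (I : R) :
  measurable_fun setT F -> (forall x, 0 <= F x) ->
  (\int[@leb01 R]_x (F x)%:E = I%:E)%E ->
  (\int[leb_cube R n]_t (\prod_(i < n) F (tnth t i))%:E = (I ^+ n)%:E)%E.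
Proof.
move=> mF F0 FI; have I0 : 0 <= I.
  by rewrite -lee_fin -FI; apply: integral_ge0 => x _; rewrite lee_fin.
have mprod m : measurable_fun setT (fun t : m.-tuple R => \prod_(i < m) F (tnth t i)).
  apply: measurable_prod => i _; exact: (measurableT_comp mF (measurable_tnth i)).
elim: n => [|n ih].
  rewrite /= integral_dirac//; last by apply/measurable_EFinP; exact: (mprod 0%N).
  by rewrite big_ord0 mule1; exact: diracT.
have mc := @measurable_cons_pair R n.
rewrite (eq_measure_integral (pushforward (@leb01 R \x leb_cube R n)%E (@cons_pair R n)))//.
have m1 : measurable_fun setT (fun t : n.+1.-tuple R =>
    (\prod_(i < n.+1) F (tnth t i))%:E).
  by apply/measurable_EFinP; exact: mprod.
rewrite ge0_integral_pushforward//; last first.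
  by move=> t _; rewrite lee_fin prodr_ge0.
rewrite preimage_setT fubini_tonelli1; last 2 first.
- exact: (measurableT_comp m1 mc).
- by move=> z; rewrite lee_fin prodr_ge0.
rewrite (eq_integral (fun x => (F x)%:E * (I ^+ n)%:E)%E) => [|x _].
  rewrite ge0_integralZr//.
  - by rewrite FI exprS.
  - exact/measurable_EFinP.
  - by move=> y _; rewrite lee_fin.
  - by rewrite lee_fin exprn_ge0.
rewrite /fubini_F -ih -ge0_integralZl//.
- apply: eq_integral => t _; rewrite /= big_ord_recl -EFinM; congr (_ * _)%:E.
  by apply: eq_bigr => i _; rewrite tnthS.
- by apply/measurable_EFinP; exact: mprod.
- by move=> t _; rewrite lee_fin prodr_ge0.
- by rewrite lee_fin.
Qed.

End power_integral.

(** * Lower bound *)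

Section lower_bound.
Variables (R : realType) (s : nat) (p : \bar R) (gamma : {set 'I_s} -> R).
Implicit Types (u v w : {set 'I_s}) (c : {set 'I_s} -> R)
  (h : forall u, #|u|.-tuple R -> R) (phi : R -> R).
Hypothesis p1 : (1 <= p)%E.
Hypothesis gamma_ge0 : forall u, 0 <= gamma u.

Notation leb u := (leb_cube R #|u|).
Notation U := (active gamma).

Lemma powR_prod (I : Type) (r : seq I) (P : pred I) (F : I -> R) (b : R) :
  (forall i, P i -> 0 <= F i) ->
  (\prod_(i <- r | P i) F i) `^ b = \prod_(i <- r | P i) F i `^ b.
Proof.
move=> F0; suff [] : 0 <= \prod_(i <- r | P i) F i /\
  (\prod_(i <- r | P i) F i) `^ b = \prod_(i <- r | P i) F i `^ b by [].
apply: (big_ind2 (fun x y => 0 <= x /\ x `^ b = y)).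
- by rewrite powR1.
- move=> x y x' y' [x0 <-] [x0' <-].
  by rewrite powRM// mulr_ge0.
- by move=> i Pi; rewrite F0.
Qed.

Definition tensor phi u (t : #|u|.-tuple R) : R := \prod_(j in u) phi (coord t j).

Lemma tensorE phi u (t : #|u|.-tuple R) :
  tensor phi t = \prod_(i < #|u|) phi (tnth t i).
Proof.
rewrite /tensor (big_enum_val (fun j => phi (coord t j))).
by apply: eq_bigr => i _; rewrite coord_enum_val.
Qed.

Lemma measurable_tensor phi u : measurable_fun setT phi ->
  measurable_fun setT (@tensor phi u).
Proof. by move=> mphi; apply: (@measurable_prod_coord _ _ _ _ (fun=> phi)). Qed.

Lemma Lnorm_tensor (r : R) phi u : 1 <= r -> measurable_fun setT phi ->
  (forall x, 0 <= phi x) -> (\int[@leb01 R]_x (phi x `^ r)%:E = 1)%E ->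
  Lp_norm r%:E (@tensor phi u) = 1%E.
Proof.
move=> r1 mphi phi0 phi1; rewrite /Lp_norm unlock.
rewrite (eq_integral (fun t : #|u|.-tuple R =>
    (\prod_(i < #|u|) (phi (tnth t i) `^ r))%:E)) => [|t _].
  rewrite (@integral_prod_tnth _ _ (fun x => phi x `^ r) 1)//.
    by rewrite expr1n poweR1r.
    exact: (measurableT_comp (measurable_powR r) mphi).
  by move=> x; exact: powR_ge0.
by rewrite /= tensorE ger0_norm ?prodr_ge0// powR_prod.
Qed.

Lemma integrable_tensor_weight phi (mu1 : R) w : measurable_fun setT phi ->
  (forall x, 0 <= phi x) -> (\int[@leb01 R]_x (phi x * `|1 - x|)%:E = mu1%:E)%E ->
  (leb w).-integrable setT
    (EFin \o (fun t => tensor phi t * \prod_(j in w) (1 - coord t j))).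
Proof.
move=> mphi phi0 phi1; apply/integrableP; split.
  apply/measurable_EFinP; apply: measurable_funM; first exact: measurable_tensor.
  by apply: (@measurable_prod_coord _ _ _ _ (fun _ x => 1 - x)) => _; exact: measurable_onem.
rewrite (eq_integral (fun t : #|w|.-tuple R =>
    (\prod_(i < #|w|) (phi (tnth t i) * `|1 - tnth t i|))%:E)) => [|t _].
  rewrite (@integral_prod_tnth _ _ (fun x => phi x * `|1 - x|) mu1)//.
  - by rewrite ltry.
  - apply: measurable_funM => //; apply: measurableT_comp => //.
    exact: measurable_onem.
  - by move=> x; rewrite mulr_ge0.
rewrite /= normrM !normr_prod -big_split/=.
rewrite (big_enum_val (fun j => `|phi (coord t j)| * `|1 - coord t j|)).
by congr (_%:E); apply: eq_bigr => i _; rewrite coord_enum_val ger0_norm.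
Qed.

Lemma Rintegral_tensor_weight phi (mu1 : R) w : measurable_fun setT phi ->
  (forall x, 0 <= phi x) -> (\int[@leb01 R]_x (phi x * `|1 - x|)%:E = mu1%:E)%E ->
  \int[leb w]_t (tensor phi t * \prod_(j in w) (1 - coord t j)) = mu1 ^+ #|w|.
Proof.
move=> mphi phi0 phi1.
have mF : measurable_fun setT (fun x => phi x * `|1 - x|).
  by apply: measurable_funM => //; apply: measurableT_comp => //; exact: measurable_onem.
have F0 x : 0 <= phi x * `|1 - x| by rewrite mulr_ge0.
have := integral_prod_tnth #|w| mF F0 phi1 => /(congr1 fine)/= <-.
apply: ae_eq_Rintegral.
- apply: measurable_funM; first exact: measurable_tensor.
  by apply: (@measurable_prod_coord _ _ _ _ (fun _ x => 1 - x)) => _; exact: measurable_onem.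
- apply: measurable_prod => i _; exact: (measurableT_comp mF (measurable_tnth i)).
apply: filterS (ae_coord_itv R w) => t t01.
rewrite -big_split/= (big_enum_val (fun j => phi (coord t j) * (1 - coord t j))).
apply: eq_bigr => i _; have /andP[_ t1] := t01 (enum_val i).
by rewrite coord_enum_val in t1 *; rewrite ger0_norm// subr_ge0 ltW.
Qed.

Lemma tensor_glue phi v w (x : #|v|.-tuple R) (t : #|w|.-tuple R) :
  w \subset ~: v -> tensor phi (glue x t) = tensor phi x * tensor phi t.
Proof.
move=> wv; rewrite /tensor big_setU_subC//=; congr (_ * _).
  by apply: eq_bigr => j jv; rewrite coord_glue_l.
by apply: eq_bigr => j jw; rewrite coord_glue_r.
Qed.

(** For product functions the integral over [w] separates into [mu1 ^+ #|w|], so the result is a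
    scalar multiple of the tensor on [v]. *)
Lemma mixed_tensor phi (mu1 : R) c v (x : #|v|.-tuple R) :
  measurable_fun setT phi -> (forall x, 0 <= phi x) ->
  (\int[@leb01 R]_x (phi x * `|1 - x|)%:E = mu1%:E)%E ->
  mixed gamma c (fun u t => gamma u * tensor phi t) x =
  (\sum_(w : {set 'I_s} | (w \subset ~: v) && (v :|: w \in U))
     c (v :|: w) * gamma (v :|: w) * mu1 ^+ #|w|) * tensor phi x.
Proof.
move=> mphi phi0 phi1; rewrite mulr_suml; apply: eq_bigr => w /andP[wv _].
rewrite -!mulrA; congr (_ * _).
rewrite -(Rintegral_tensor_weight w mphi phi0 phi1).
transitivity (\int[leb w]_t ((gamma (v :|: w) * tensor phi x) *
    (tensor phi t * \prod_(j in w) (1 - coord t j)))).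
  apply: eq_Rintegral => t _; rewrite tensor_glue//.
  by rewrite !mulrA.
rewrite RintegralZl//; first by rewrite -!mulrA; congr (_ * _); rewrite mulrC.
exact: integrable_tensor_weight phi1.
Qed.

Lemma m_const_ge0 q : 0 <= m_const (R := R) q.
Proof. by case: q => [r||]; rewrite /m_const ?powR_ge0. Qed.

(* [phi] is a multiple of a power of [|1 - x|]: the extremal function of the
   Hoelder inequality between [phi] and [1 - x] if [1 < p], and a function
   concentrated near 0 if [p = 1], where there is no extremal function. *)
Lemma exists_test_function (theta : R) : 0 < theta < 1 ->
  exists phi mu1, [/\ measurable_fun setT phi, forall x, 0 <= phi x,
    forall u, Lp_norm p (@tensor phi u) = 1%E,
    (\int[@leb01 R]_x (phi x * `|1 - x|)%:E = mu1%:E)%E &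
    theta * m_const (hoelder_conjugate p) <= mu1].
Proof.
move=> /andP[th0 th1].
have mpow (b : R) : measurable_fun setT (fun x : R => `|1 - x| `^ b).
  apply: (measurableT_comp (measurable_powR b)); apply: measurableT_comp => //.
  exact: measurable_onem.
pose phi (C a x : R) := C * `|1 - x| `^ a.
have mphi C a : measurable_fun setT (phi C a) by exact: measurable_funM.
have phi0 C a x : 0 <= C -> 0 <= phi C a x by move=> C0; rewrite mulr_ge0// powR_ge0.
have integral_phi C b : 0 <= C -> 0 <= b ->
    (\int[@leb01 R]_x (C * `|1 - x| `^ b)%:E = (C / (b + 1))%:E)%E.
  move=> C0 b0; under eq_integral do rewrite EFinM.
  rewrite ge0_integralZl// ?lee_fin//; last first.
  - exact/measurable_EFinP.
  by rewrite integral_leb01_powR.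
have phi_weight C a : 0 <= C -> 0 <= a ->
    (\int[@leb01 R]_x (phi C a x * `|1 - x|)%:E = (C / (a + 2))%:E)%E.
  move=> C0 a0; rewrite (_ : a + 2 = a + 1 + 1); last by ring.
  rewrite -integral_phi ?addr_ge0//; apply: eq_integral => x _.
  by rewrite /phi -mulrA powRD ?powRr1// gt_eqF// ltr_wpDl.
case: p p1 => [r r1|_|//]; last first.
  (* For $p=\infty$ the constant 1 is extremal, and its integral against $1-x$ is $1/2 = m_1$. *)
  exists (phi 1 0), (1 / (0 + 2)); split => //.
  - by move=> x; exact: phi0.
  - move=> u; rewrite /Lp_norm (_ : EFin \o _ = EFin \o cst 1).
      by rewrite Lnorm_cst ?leey//; congr EFin; exact: normr1.
    apply/funext => t; congr EFin; rewrite /tensor big1// => j _.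
    by rewrite /phi powRr0 mulr1.
  - by rewrite phi_weight.
  rewrite hoelder_conjugatey /m_const invr1 powR_inv1// add0r div1r.
  rewrite (_ : 1 + 1 = 2) // ler_piMl// ?invr_ge0// ltW//.
rewrite lee_fin in r1; have r0 : 0 < r by rewrite (lt_le_trans ltr01).
(* The constant $(ar+1)^{1/r}$ normalises $|1-x|^a$ in $L_r$, and $\int (1-x)^{a+1} = 1/(a+2)$; only
   the exponent [a] is left to choose. *)
suff [a a0 mle] : exists2 a : R, 0 <= a & theta * m_const (hoelder_conjugate r%:E) <=
    (a * r + 1) `^ r^-1 / (a + 2).
  have C0 : 0 <= (a * r + 1) `^ r^-1 by exact: powR_ge0.
  have ar0 : 0 <= a * r by rewrite mulr_ge0// ltW.
  exists (phi ((a * r + 1) `^ r^-1) a), ((a * r + 1) `^ r^-1 / (a + 2)); split => //.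
  - by move=> x; exact: phi0.
  - move=> u; apply: Lnorm_tensor => // [x|]; first exact: phi0.
    rewrite (eq_integral (fun x : R => ((a * r + 1) * `|1 - x| `^ (a * r))%:E)) => [|x _].
      by rewrite integral_phi ?addr_ge0// mulfV// gt_eqF// ltr_wpDl.
    rewrite /phi powRM ?powR_ge0// -powRrM mulVf ?gt_eqF// powRr1 ?addr_ge0//.
    by rewrite -powRrM.
  - exact: phi_weight.
move: r1; rewrite le_eqVlt => /predU1P[<-|r1].
  have th0' : 0 < 1 - theta by rewrite subr_gt0.
  (* For $p=1$ the bound is $(a+1)/(a+2) \ge \theta$, that is $a(1-\theta) \ge 2\theta - 1$, and
     here the left side is 1. *)
  exists (1 - theta)^-1; first by rewrite invr_ge0 ltW.
  rewrite hoelder_conjugate1 /m_const mulr1 mulr1 invr1 powRr1; last first.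
    by rewrite addr_ge0// invr_ge0 ltW.
  have a0 : 0 < (1 - theta)^-1 by rewrite invr_gt0.
  have : (1 - theta)^-1 * (1 - theta) = 1 by rewrite mulVf// gt_eqF.
  move: (1 - theta)^-1 a0 => a a0 ath; rewrite ler_pdivlMr ?addr_gt0//.
  lra.
have r10 : 0 < r - 1 by rewrite subr_gt0.
have hq : hoelder_conjugate r%:E = (r / (r - 1))%:E.
  by rewrite /hoelder_conjugate/= eqe gt_eqF// -EFinB inver subr_eq0 gt_eqF// -EFinM.
(* Equality case of Hoelder: $ar = r/(r-1) = p^*$ and $a+2 = p^*+1$, so the value is exactly
   $(p^*+1)^{1/r-1} = m_{p^*}$. *)
exists (r - 1)^-1; first by rewrite invr_ge0 ltW.
rewrite hq /m_const.
have -> : (r - 1)^-1 * r + 1 = r / (r - 1) + 1 by rewrite mulrC.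
have -> : (r - 1)^-1 + 2 = r / (r - 1) + 1.
  by field; rewrite gt_eqF.
set Q := r / (r - 1) + 1.
have Q0 : 0 < Q by rewrite ltr_wpDl// divr_ge0// ltW.
have -> : Q `^ r^-1 / Q = Q `^ (- (r / (r - 1))^-1).
  rewrite -{2}(powRr1 (ltW Q0)) -powRN -powRD; last by rewrite (gt_eqF Q0) implybT.
  by congr (_ `^ _); field; rewrite !gt_eqF.
by rewrite ler_piMl ?powR_ge0// ltW.
Qed.

Lemma le_weighted_lp_norm_scale (rho : R) (N N' : {set 'I_s} -> \bar R) : 0 < rho ->
  (forall u, u \in U -> 0 <= N u)%E ->
  (forall u, u \in U -> rho%:E * N u <= N' u)%E ->
  (rho%:E * weighted_lp_norm p gamma N <= weighted_lp_norm p gamma N')%E.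
Proof.
move=> rho0 N0 NN'; rewrite /weighted_lp_norm; case: p p1 => [r|_|//]; last first.
  apply: (big_ind2 (fun a b => rho%:E * a <= b)%E); first by rewrite mule0.
    move=> a b a' b' ab a'b'; rewrite le_max; case: (leP a a') => _.
      by rewrite a'b' orbT.
    by rewrite ab.
  move=> u uU; rewrite muleCA lee_wpmul2l ?NN'//.
  by rewrite lee_fin invr_ge0.
rewrite lee_fin => r1; have r0 : 0 < r by rewrite (lt_le_trans ltr01).
have S0 (M : {set 'I_s} -> \bar R) :
    (0 <= \sum_(u in U) (gamma u `^ (- r))%:E * M u `^ r)%E.
  by apply: sume_ge0 => u _; rewrite mule_ge0// ?lee_fin ?powR_ge0// poweR_ge0.
have -> : rho%:E = ((rho `^ r)%:E `^ r^-1)%E.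
  by rewrite poweR_EFin -powRrM mulfV ?gt_eqF// powRr1// ltW.
rewrite -poweRM ?lee_fin ?powR_ge0//.
apply: gt0_ler_poweR; first by rewrite invr_ge0 ltW.
- by rewrite in_itv/= leey andbT mule_ge0// lee_fin powR_ge0.
- by rewrite in_itv/= leey andbT.
rewrite ge0_sume_distrr; last first.
  by move=> u _; rewrite mule_ge0// ?lee_fin ?powR_ge0// poweR_ge0.
apply: lee_sum => u uU; rewrite muleCA lee_wpmul2l ?lee_fin ?powR_ge0//.
rewrite -poweR_EFin -poweRM ?lee_fin ?(ltW rho0) ?N0//.
have rN0 : (0 <= rho%:E * N u)%E by rewrite mule_ge0 ?N0// lee_fin ltW.
apply: gt0_ler_poweR; first exact: ltW.
- by rewrite in_itv/= leey andbT.
- by rewrite in_itv/= leey andbT (le_trans rN0)// NN'.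
exact: NN'.
Qed.

(** The test functions reach $m_{p^*}$ up to a factor $\theta<1$, so each quotient is attained up to
    an arbitrary factor [rho < 1], which suffices for the supremum. *)
Lemma le_mixed_ratios c : (forall u, u \in U -> 0 <= c u) ->
  (exists2 u, u \in U & c u != 0) ->
  (weighted_lp_norm p gamma (fun v =>
     (\sum_(w : {set 'I_s} | (w \subset ~: v) && (v :|: w \in U))
        c (v :|: w) * gamma (v :|: w) *
        m_const (hoelder_conjugate p) ^+ #|w|)%R%:E) / lp_norm p gamma c <=
   ereal_sup (mixed_ratios p gamma))%E.
Proof.
move=> c0 cn0.
set m := m_const _; have m0 : 0 <= m := m_const_ge0 _.
have Nge0 (x : R) v : 0 <= x ->
    0 <= \sum_(w : {set 'I_s} | (w \subset ~: v) && (v :|: w \in U))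
                c (v :|: w) * gamma (v :|: w) * x ^+ #|w|.
  move=> x0; apply: sumr_ge0 => w /andP[_ vwU].
  by rewrite !mulr_ge0 ?c0 ?exprn_ge0.
have lp0 : (0 <= lp_norm p gamma c)%E.
  rewrite /lp_norm; case: p => [r||//]; last exact: bigmax_ge_id.
  by rewrite poweR_ge0.
have W0 N : (0 <= weighted_lp_norm p gamma N)%E.
  rewrite /weighted_lp_norm; case: p => [r||//]; last exact: bigmax_ge_id.
  by rewrite poweR_ge0.
apply/lee_mul01Pr; first by rewrite mule_ge0// inve_ge0.
move=> rho /andP[rho0 rho1].
(* At most [s] factors [theta] are lost in a term, and $\theta^{|w|} \ge \theta^{s+1} = \rho$; the
   root of order [s.+1] also makes sense for [s = 0]. *)
pose theta := rho `^ s.+1%:R^-1.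
have s0 : 0 < s.+1%:R :> R by rewrite ltr0n.
have thE : theta ^+ s.+1 = rho.
  by rewrite -powR_mulrn ?powR_ge0// -powRrM mulVf ?gt_eqF// powRr1// ltW.
have th0 : 0 < theta by rewrite powR_gt0.
have th1 : theta < 1.
  by rewrite ltNge; apply/negP => /(exprn_ege1 s.+1); rewrite thE leNgt rho1.
have [|phi [mu1 [mphi phi0 phiN phi1 mmu]]] := @exists_test_function theta.
  by rewrite th0.
pose h u t := gamma u * @tensor phi u t.
have tensorp u : @tensor phi u \in Lfun (leb u) p.
  apply/Lfun_normP; split; first exact: measurable_tensor.
  by rewrite -/(Lp_norm p (@tensor phi u)) phiN ltry.
have LpN (a : R) u : Lp_norm p (fun t => a * @tensor phi u t) = `|a|%:E.
  apply: etrans (Lnorm_scale _ p1 (tensorp u)) _.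
  by rewrite -[RHS]mule1; congr (_ * _)%E; exact: phiN.
have mu0 : 0 <= mu1 by rewrite (le_trans _ mmu)// mulr_ge0// ltW.
rewrite muleA; apply: le_trans (ereal_sup_ubound _); last first.
  exists c, h; split=> // u uU.
    exact: (LfunZ _ p1 (tensorp u)).
  by rewrite LpN ger0_norm.
apply: lee_wpmul2r; first by rewrite inve_ge0.
apply: le_weighted_lp_norm_scale => // v vU; first by rewrite lee_fin Nge0.
rewrite (_ : @mixed _ _ _ c h v = fun x => (\sum_(w : {set 'I_s} |
     (w \subset ~: v) && (v :|: w \in U))
     c (v :|: w) * gamma (v :|: w) * mu1 ^+ #|w|) * tensor phi x); last first.
  by apply/funext => x; exact: mixed_tensor.
rewrite LpN -EFinM lee_fin.
rewrite ger0_norm ?Nge0// mulr_sumr; apply: ler_sum => w /andP[_ vwU].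
rewrite mulrCA ler_wpM2l ?mulr_ge0 ?c0//.
rewrite (@le_trans _ _ ((theta * m) ^+ #|w|))//; last first.
  by apply: lerXn2r => //; rewrite nnegrE// mulr_ge0// ltW.
rewrite exprMn ler_wpM2r ?exprn_ge0// -thE ler_wiXn2l ?ltW//.
by rewrite leqW// -[leqRHS]card_ord max_card.
Qed.

End lower_bound.

Theorem theorem1 (R : realType) (s : nat) (p : \bar R)
    (gamma : {set 'I_s} -> R)
    (hp : (1 <= p)%E)
    (gamma_ge0 : forall u, 0 <= gamma u)
    (gamma_neq0 : exists u, gamma u != 0)
    (gamma_down : forall u w : {set 'I_s},
       u \subset w -> 0 < gamma w -> 0 < gamma u) :
  let U := active gamma in
  let norm_i := embedding_norm p gamma (@anchored_kernel R) (@anova_kernel R) in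
  let norm_i_inv :=
    embedding_norm p gamma (@anova_kernel R) (@anchored_kernel R) in
  let S :=
    ereal_sup [set q : \bar R |
      exists (c : {set 'I_s} -> R)
             (h : forall u : {set 'I_s}, #|u|.-tuple R -> R),
        [/\ forall u, u \in U -> 0 <= c u,
            exists2 u, u \in U & c u != 0,
            forall u, u \in U -> h u \in Lfun (leb_cube R #|u|) p,
            forall u, u \in U -> Lp_norm p (h u) = (gamma u)%:E
          & q = (weighted_lp_norm p gamma
                   (fun v => Lp_norm p (@mixed R s gamma c h v)) /
                 lp_norm p gamma c)%E]] in
  let L :=
    ereal_sup [set q : \bar R |
      exists c : {set 'I_s} -> R,
        [/\ forall u, u \in U -> 0 <= c u,
            exists2 u, u \in U & c u != 0
          & q = (weighted_lp_norm p gamma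
                   (fun v => (\sum_(w : {set 'I_s} |
                                 (w \subset ~: v) && (v :|: w \in U))
                                c (v :|: w) * gamma (v :|: w) *
                                m_const (hoelder_conjugate p) ^+ #|w|)%:E) /
                 lp_norm p gamma c)%E]] in
  [/\ norm_i = S, norm_i_inv = S, (L <= norm_i)%E & (L <= norm_i_inv)%E].
Proof.
move=> U norm_i norm_i_inv S L.
have iE : norm_i = S.
  apply: (embedding_normE hp gamma_down (expr1n _ 2)).
  - exact: regular_anchored_kernel.
  - exact: regular_anova_kernel.
  - exact: faithful_anchored_kernel.
  - exact: faithful_anova_kernel.
  - exact: anchored_kernelE.
(* Both directions give the same set of quotients: the sign [e] is 1 for the embedding and -1 for
   its inverse. *)
have iiE : norm_i_inv = S.
  have e2 : (-1) ^+ 2 = 1 :> R by rewrite sqrrN expr1n.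
  apply: (embedding_normE hp gamma_down e2).
  - exact: regular_anova_kernel.
  - exact: regular_anchored_kernel.
  - exact: faithful_anova_kernel.
  - exact: faithful_anchored_kernel.
  - exact: anova_kernelE.
have LS : (L <= S)%E.
  by apply: ge_ereal_sup => _ [c [c0 cn0 ->]]; exact: le_mixed_ratios.
by rewrite iE iiE.
Qed.
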